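(* Let $P=(\mathbf p,\mathbf r)$ be a packing of $n$ disks inside of a tri-cusp, and suppose that the vector $\bar{\mathbf r}=(r_1,r_2,r_3,\bar r_4,\dots,\bar r_{n-1})$ is generic in $\mathbb{R}^{n-1}$, where $\bar r_j=r_j/r_n$ for $j=4,\dots,n-1$. Then $P$ cannot have more than $2n-2$ contacts. If $P$ is infinitesimally collectively jammed, then it has exactly $2n-2$ contacts.
   Context: A vector in $\mathbb{R}^N$ is generic if its coordinates are algebraically independent over $\mathbb{Q}$. A disk packing $(\mathbf p,\mathbf r)$ consists of centers $\mathbf p=(\mathbf p_1,\dots,\mathbf p_n)\in(\mathbb{R}^2)^n$ and radii $\mathbf r=(r_1,\dots,r_n)$, $r_i>0$, such that the disks have pairwise disjoint interiors. Its contact graph $G$ has vertex set $\{1,\dots,n\}$ and an edge $ij$ whenever disks $i$ and $j$ are tangent; the contacts of the packing are the edges of $G$. A packing inside of a tri-cusp is a disk packing in which the first three disks are in mutual contact and the remaining $n-3$ (''internal'') disks lie in the interior tri-cusp-shaped region bounded by these first three disks. Here $n\ge 4$. The contact graph $G$ thus includes the triangle $\{1,2,3\}$ (the outer triangle), whose three edges are counted among the contacts. An infinitesimal tensegrity flex of a packing $(\mathbf p,\mathbf r)$ in a tri-cusp with contact graph $G$ is a vector $\mathbf p'=(\mathbf p'_1,\dots,\mathbf p'_n)\in(\mathbb{R}^2)^n$ such that $(\mathbf p_j-\mathbf p_i)\cdot(\mathbf p'_j-\mathbf p'_i)=0$ on the three edges $ij$ of the outer triangle and $(\mathbf p_j-\mathbf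 p_i)\cdot(\mathbf p'_j-\mathbf p'_i)\ge 0$ on all the other edges $ij$ of $G$. The packing is infinitesimally collectively jammed if its only infinitesimal tensegrity flexes are the trivial ones, i.e. those in the $3$-dimensional space of infinitesimal motions arising from Euclidean isometries of the plane. *)

(* Defs.v *)
From HB Require Import structures.
From mathcomp Require Import all_boot all_order all_algebra.
From mathcomp Require Import all_classical all_reals all_analysis.
From mathcomp Require mpoly.
(* Only the canonical structures: the notations of mpoly clash with those of
   mathcomp-analysis. *)
Import (canonicals) mpoly.

Set Implicit Arguments.
Unset Strict Implicit.
Unset Printing Implicit Defensive.

Import Order.TTheory GRing.Theory Num.Theory.
Import numFieldNormedType.Exports.

Local Open Scope classical_set_scope.
Local Open Scope ring_scope.

(* The coordinates of [v] are algebraically independent over the rationals. *)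
Definition generic (R : realType) (N : nat) (v : 'I_N -> R) : Prop :=
  forall P : mpoly.mpoly N rat, mpoly.mmap ratr v P = 0 -> P = 0.

Definition dot (R : realType) (u v : 'rV[R]_2) : R :=
  \sum_(k < 2) u 0 k * v 0 k.

(* Euclidean norm; the library's norm on ['rV[R]_2] is the sup norm. *)
Definition enorm (R : realType) (u : 'rV[R]_2) : R := Num.sqrt (dot u u).

Definition disk (R : realType) (c : 'rV[R]_2) (rho : R) : set 'rV[R]_2 :=
  [set x | enorm (x - c) <= rho].

(* The disk [i] has center [p i] and radius [r i]. *)
Definition disk_packing (R : realType) (n : nat)
    (p : 'I_n -> 'rV[R]_2) (r : 'I_n -> R) : Prop :=
  (forall i, 0 < r i) /\
  (forall i j, i != j ->
     (disk (p i) (r i))° `&` (disk (p j) (r j))° = set0).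

(* External tangency, the only one possible for disks with disjoint
   interiors. *)
Definition tangent (R : realType) (n : nat)
    (p : 'I_n -> 'rV[R]_2) (r : 'I_n -> R) : rel 'I_n :=
  fun i j => (i != j) && (enorm (p i - p j) == r i + r j).

(* Each edge of the contact graph is listed once, as a pair [(i, j)] with
   [i < j]. *)
Definition contacts (R : realType) (n : nat)
    (p : 'I_n -> 'rV[R]_2) (r : 'I_n -> R) : {set 'I_n * 'I_n} :=
  [set e : 'I_n * 'I_n | (e.1 < e.2)%N && tangent p r e.1 e.2]%SET.

(* Indices start at 0, so the three outer disks are 0, 1 and 2. *)
Definition outer (n : nat) (i : 'I_n) : bool := (i < 3)%N.

(* The open tri-cusp: the union of the bounded connected components of the
   complement of the (closed) outer disks.  There is exactly one such component
   when the outer disks are in mutual external contact. *)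
Definition tricusp (R : realType) (n : nat)
    (p : 'I_n -> 'rV[R]_2) (r : 'I_n -> R) : set 'rV[R]_2 :=
  let gap := ~` \bigcup_(i in [set i : 'I_n | outer i]) disk (p i) (r i) in
  [set x | gap x /\ bounded_set (connected_component gap x)].

(* An internal disk may touch the outer disks, hence the closure. *)
Definition tricusp_packing (R : realType) (n : nat)
    (p : 'I_n -> 'rV[R]_2) (r : 'I_n -> R) : Prop :=
  [/\ disk_packing p r,
      forall i j, outer i -> outer j -> i != j -> tangent p r i j &
      forall i, ~~ outer i ->
        disk (p i) (r i) `<=` closure (tricusp p r)].

Definition inf_tensegrity_flex (R : realType) (n : nat)
    (p : 'I_n -> 'rV[R]_2) (r : 'I_n -> R) (p' : 'I_n -> 'rV[R]_2) : Prop :=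
  forall i j, tangent p r i j ->
    if outer i && outer j then dot (p j - p i) (p' j - p' i) = 0
    else 0 <= dot (p j - p i) (p' j - p' i).

(* The Lie algebra of the group of Euclidean isometries of the plane consists
   of the vector fields [x |-> x *m A + t] with [A] skew-symmetric. *)
Definition trivial_flex (R : realType) (n : nat)
    (p : 'I_n -> 'rV[R]_2) (p' : 'I_n -> 'rV[R]_2) : Prop :=
  exists (A : 'M[R]_2) (t : 'rV[R]_2),
    A^T = - A /\ forall i, p' i = p i *m A + t.

Definition inf_collectively_jammed (R : realType) (n : nat)
    (p : 'I_n -> 'rV[R]_2) (r : 'I_n -> R) : Prop :=
  forall p', inf_tensegrity_flex p r p' -> trivial_flex p p'.

Lemma last_disk_subproof (n : nat) : (4 <= n)%N -> (n.-1 < n)%N.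
Proof. by case: n. Qed.

Definition last_disk (n : nat) (hn : (4 <= n)%N) : 'I_n :=
  Ordinal (last_disk_subproof hn).

(* (r_1, r_2, r_3, r_4 / r_n, ..., r_(n-1) / r_n) in 1-based indexing. *)
Definition rbar (R : realType) (n : nat) (hn : (4 <= n)%N) (r : 'I_n -> R) :
    'I_n.-1 -> R :=
  fun k => let i := widen_ord (leq_pred n) k in
    if outer i then r i else r i / r (last_disk hn).

(* Main.v *)
Require Import Defs.
From HB Require Import structures.
From mathcomp Require Import all_boot all_order all_algebra.
From mathcomp Require Import all_classical all_reals all_analysis.
From mathcomp Require mpoly.
Import (canonicals) mpoly.
From mathcomp Require Import ring lra zify.

Set Implicit Arguments.
Unset Strict Implicit.
Unset Printing Implicit Defensive.

Import Order.TTheory GRing.Theory Num.Theory.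
Import numFieldNormedType.Exports.

Local Open Scope ring_scope.

(** Write B for the linear map that sends a velocity of centers and radii to
    the derivatives, along the m contacts ij, of
    |p_i - p_j|^2 - (r_i + r_j)^2.  The bound m <= 2n - 2 comes from two
    independent facts about the kernel of B.

    First, the m conditions are independent ([contact_matrix_rank]), so the
    kernel has dimension 3n - m.  A linear dependency would be a stress w on
    the contacts such that, at every disk i, the sums over j of
    w_ij (p_j - p_i) and of w_ij (r_i + r_j) vanish.  Around disk i this says
    that weights placed at the contact points of one circle annihilate all
    affine functions.  Parametrizing the circle rationally turns affine
    functions into quadratic polynomials, and a nonzero weight that annihilates
    quadratics has at least three sign changes in linear order, hence four in
    cyclic order ([moment_changes]).  The contact segments do not cross
    ([contact_plane_graph]), and Cauchy's counting argument shows that a plane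
    straight-line graph cannot have four sign changes at every vertex
    ([few_changes]).  The count avoids Euler's formula: the graph is extended to a
    maximal plane graph, and each triangle is charged to its vertex with the
    middle abscissa.  A vertex is charged at most twice, once from above and
    once from below, while the three corners of a triangle show at most two
    sign changes.

    Second, genericity makes the kernel large.  As the numbers rbar_k are
    algebraically independent over the rationals, there are derivations, defined
    on a subring of the reals that contains all coordinates and radii, taking
    arbitrary values at the rbar_k ([generic_derivation]).  Such a derivation,
    applied to the tangency equations, gives an element of the kernel.  Hence
    the kernel maps onto an (n-1)-dimensional space by the differential of rbar
    ([ratio_matrix_onto]), and the kernel of that map contains the
    three-dimensional space of infinitesimal isometries.  So 3n - m >= (n - 1) + 3.

    The lower bound for a jammed packing is linear algebra
    ([contacts_lower_bound]).  All motions that preserve every contact to first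
    order are infinitesimal isometries, so the m rows of the rigidity matrix have rank at
    least 2n - 3.  If m <= 2n - 3, they are independent, and some motion opens
    every contact outside the outer triangle at unit rate while preserving the
    outer triangle.  That motion is a nontrivial flex, because m > 3. *)

(** * Sign changes and vanishing moments *)

Section SignChanges.
Variable R : realFieldType.

Lemma sorted_head_min (T : eqType) (k : T -> R) a s :
  sorted (fun i j => k i < k j) (a :: s) ->
  forall i, i \in a :: s -> k a <= k i.
Proof.
move=> srt i; rewrite inE => /predU1P[-> //|is_]; apply: ltW.
have tr : transitive (fun u v => k u < k v) by move=> ? ? ?; apply: lt_trans.
by move: (order_path_min tr srt) => /allP /(_ _ is_).
Qed.

Lemma sorted_last_max (T : eqType) (k : T -> R) a s :
  sorted (fun i j => k i < k j) (a :: s) ->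
  forall i, i \in a :: s -> k i <= k (last a s).
Proof.
elim: s a => [|b s IH] a; first by move=> _ i; rewrite inE => /eqP ->.
move=> /= /andP[ab srt] i; rewrite inE => /predU1P[->|]; last exact: IH.
by apply: le_trans (ltW ab) (IH b srt b _); rewrite inE eqxx.
Qed.

Fixpoint changes (T : Type) (c : T -> bool) (s : seq T) : nat :=
  if s is a :: s' then
    (if s' is b :: _ then (c a != c b) + changes c s' else 0)%N
  else 0%N.

Lemma changes_cons2 (T : Type) (c : T -> bool) a b s :
  changes c [:: a, b & s] = ((c a != c b) + changes c (b :: s))%N.
Proof. by []. Qed.

Lemma odd_changes (T : Type) (c : T -> bool) a s :
  odd (changes c (a :: s)) = (c a != c (last a s)).
Proof.
elim: s a => [|b s IH] a; first by rewrite /= eqxx.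
rewrite changes_cons2 oddD IH /=.
by case: (c a) (c b) (c (last b s)) => [] [] [].
Qed.

(** One root placed between the two points of each sign change gives a
    polynomial with prescribed signs at all points of the list.  The control on
    the whole half-line left of the first point is what the induction needs to
    place the next root. *)
Lemma sign_polynomial (T : eqType) (k : T -> R) (c : T -> bool) a s :
  sorted (fun u v => k u < k v) (a :: s) ->
  exists q : {poly R}, [/\ (size q <= (changes c (a :: s)).+1)%N,
    (forall t, t <= k a -> 0 < (-1) ^+ (~~ c a) * q.[t]) &
    (forall u, u \in a :: s -> 0 < (-1) ^+ (~~ c u) * q.[k u])].
Proof.
elim: s a => [|b s IH] a.
  move=> _; exists ((-1) ^+ (~~ c a))%:P.
  have e (d : bool) : 0 < (-1) ^+ d * (-1) ^+ d :> R by rewrite -expr2 sqrr_sign.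
  split.
  - exact: size_polyC_leq1.
  - by move=> t _; rewrite hornerC.
  - by move=> u; rewrite inE => /eqP ->; rewrite hornerC.
move=> /= /andP[ab srt]; have [q [szq q1 q2]] := IH b srt.
have [cab|cab] := eqVneq (c a) (c b).
  exists q; split.
  - by rewrite add0n.
  - by move=> t ta; rewrite cab; apply: q1; apply: le_trans ta (ltW ab).
  - move=> u; rewrite inE => /predU1P[->|/q2 //].
    by rewrite cab; apply: q1; apply: ltW.
pose rho := (k a + k b) / 2.
have ar : k a < rho by rewrite /rho; lra.
have rb : rho < k b by rewrite /rho; lra.
have mono u : u \in b :: s -> k b <= k u by apply: sorted_head_min.
exists (q * ('X - rho%:P)); split.
- rewrite add1n; apply: leq_trans (size_polyMleq _ _) _.
  by rewrite size_XsubC addn2 /=.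
- move=> t ta; rewrite hornerM hornerXsubC.
  have {1}-> : (~~ c a) = ~~ ~~ c b by case: (c a) (c b) cab => [] [].
  have := q1 t (le_trans ta (ltW ab)).
  case: (c b) => /=; rewrite ?expr0 ?expr1 => h; nra.
- move=> u; rewrite inE => /predU1P[->|us].
    rewrite hornerM hornerXsubC.
    have {1}-> : (~~ c a) = ~~ ~~ c b by case: (c a) (c b) cab => [] [].
    have := q1 (k a) (ltW ab).
    case: (c b) => /=; rewrite ?expr0 ?expr1 => h; nra.
  rewrite hornerM hornerXsubC mulrA; apply: mulr_gt0; first exact: q2.
  by have := mono u us; lra.
Qed.

(** With at most two sign changes, the polynomial of [sign_polynomial] is at
    most quadratic, so its weighted sum is a combination of the three vanishing
    moments; but each term of that sum is nonnegative and one is positive. *)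
Lemma moment_changes (T : eqType) (k : T -> R) (c : T -> bool) (b : T -> R) s :
  sorted (fun u v => k u < k v) s ->
  (forall u, u \in s -> if c u then 0 <= b u else b u <= 0) ->
  (exists2 u, u \in s & b u != 0) ->
  \sum_(u <- s) b u = 0 -> \sum_(u <- s) b u * k u = 0 ->
  \sum_(u <- s) b u * k u ^+ 2 = 0 -> (2 < changes c s)%N.
Proof.
case: s => [|a s]; first by move=> _ _ [].
move=> srt sgnb [u0 u0s bu0] m0 m1 m2.
rewrite ltnNge; apply/negP => le2.
have [q [szq _ qs]] := sign_polynomial c srt.
have {}szq : (size q <= 3)%N by apply: leq_trans szq _.
have qE t : q.[t] = q`_0 + q`_1 * t + q`_2 * t ^+ 2.
  rewrite (horner_coef_wide t szq) !big_ord_recr big_ord0 /=.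
  by rewrite expr0 mulr1 add0r expr1.
have zero : \sum_(u <- a :: s) b u * q.[k u] = 0.
  under eq_bigr => u _ do rewrite qE 2!mulrDr.
  rewrite !big_split /=.
  have -> : \sum_(u <- a :: s) b u * q`_0 = 0 by rewrite -mulr_suml m0 mul0r.
  have -> : \sum_(u <- a :: s) b u * (q`_1 * k u) = 0.
    under eq_bigr => u _ do rewrite mulrCA.
    by rewrite -mulr_sumr m1 mulr0.
  under eq_bigr => u _ do rewrite mulrCA.
  by rewrite -mulr_sumr m2 mulr0 !addr0.
have nneg u : u \in a :: s -> 0 <= b u * q.[k u].
  move=> us; have := sgnb u us; have := qs u us.
  case: (c u); rewrite ?expr0 ?expr1 => h1 h2; nra.
move/eqP: zero; rewrite big_seq psumr_eq0 // => /allP /(_ _ u0s).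
rewrite u0s /= mulf_eq0 (negbTE bu0) /= => /eqP q0.
by have := qs _ u0s; rewrite q0 mulr0 ltxx.
Qed.

End SignChanges.

Definition adjacent (R : realFieldType) (T : finType) (k : T -> R) (N : {pred T})
  (b c : T) : bool :=
  [&& b \in N, c \in N, k b < k c & [forall d, (d \in N) ==> ~~ (k b < k d < k c)]].

Lemma changes_leq_adjacent (R : realFieldType) (T : finType) (k : T -> R)
    (c : T -> bool) (s : seq T) :
  sorted (fun u v => k u < k v) s ->
  (changes c s <= #|[set e : T * T | adjacent k [in s] e.1 e.2 && (c e.1 != c e.2)]|)%N.
Proof.
elim: s => [|a [|b s] IH] // srt; rewrite changes_cons2.
have /andP[ab srt'] : (k a < k b) && sorted (fun u v => k u < k v) (b :: s) by [].
have mono u : u \in b :: s -> k b <= k u by apply: sorted_head_min.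
have anin : a \notin b :: s by apply/negP => /mono; rewrite leNgt ab.
set S := [set e | _ & _]%SET; set S' := [set e | _ & _]%SET in IH.
have sub : S' \subset S.
  apply/fintype.subsetP => -[u v]; rewrite !inE /= => /andP[/and4P[us vs uv /forallP h] ->].
  rewrite /adjacent !inE in us vs *; rewrite us vs uv !orbT andbT /=.
  apply/forallP => d; rewrite inE; apply/implyP => /predU1P[->|ds].
    rewrite ltNge (le_trans (ltW ab)) //; apply: mono; rewrite inE; exact: us.
  exact: (implyP (h d) ds).
have [cab|cab] := boolP (c a != c b); last first.
  by rewrite add0n; apply: leq_trans (IH srt') (subset_leq_card sub).
rewrite add1n; apply: leq_ltn_trans (IH srt') _.
have abS : (a, b) \in S.
  rewrite !inE /= cab andbT /adjacent !inE !eqxx ab !orbT /=.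
  apply/forallP => d; rewrite inE; apply/implyP => /predU1P[->|ds].
    by rewrite ltxx.
  by rewrite andbC ltNge mono.
apply: proper_card; rewrite properE sub; apply/fintype.subsetPn; exists (a, b) => //.
by rewrite inE; apply/negP => /andP[/and4P[/= ain _ _ _] _]; move/negP: anin; apply.
Qed.

Lemma divr_gt0_mul (R : realFieldType) (u v : R) : 0 < u * v -> 0 < u / v.
Proof.
move=> uv; have v0 : v != 0 by apply: contraTneq uv => ->; rewrite mulr0 ltxx.
have -> : u / v = u * v / v ^+ 2 by rewrite expr2 invfM mulrA mulfK.
by rewrite divr_gt0 // exprn_even_gt0.
Qed.
(** * Plane straight-line graphs *)
Section PlaneGraphs.
Variables (R : realFieldType) (T : finType) (x y : T -> R).
Hypothesis xinj : injective x.

Definition through (i j k : T) : Prop := exists s : R,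
  [/\ 0 < s, s < 1, x k = x i + s * (x j - x i) & y k = y i + s * (y j - y i)].

Definition crosses (i j k l : T) : Prop := exists s t : R,
  [/\ 0 < s < 1, 0 < t < 1,
      x i + s * (x j - x i) = x k + t * (x l - x k) &
      y i + s * (y j - y i) = y k + t * (y l - y k)].

Definition plane_graph (E : {set T * T}) : Prop :=
  [/\ forall i j, (i, j) \in E -> (j, i) \in E,
      forall i j, (i, j) \in E -> i != j,
      forall i j k, (i, j) \in E -> ~ through i j k &
      forall i j k l, (i, j) \in E -> (k, l) \in E -> crosses i j k l ->
        (k, l) = (i, j) \/ (k, l) = (j, i)].

Definition maximal_plane_graph (E : {set T * T}) : Prop :=
  maxset (fun F => `[< plane_graph F >]) E.

Lemma through_sym i j k : through i j k -> through j i k.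
Proof.
move=> [s [s0 s1 hx hy]]; exists (1 - s); split; [lra|lra| |].
- by rewrite hx; ring.
- by rewrite hy; ring.
Qed.

Lemma crosses_flip i j k l : crosses i j k l -> crosses j i k l.
Proof.
move=> [s [t [s01 t01 hx hy]]]; exists (1 - s), t; split=> //; first lra.
- by rewrite -hx; ring.
- by rewrite -hy; ring.
Qed.

Lemma crosses_sym i j k l : crosses i j k l -> crosses k l i j.
Proof. by move=> [s [t [s01 t01 hx hy]]]; exists t, s. Qed.

Lemma maximal_plane_graph_exists F : plane_graph F ->
  exists2 E, maximal_plane_graph E & F \subset E.
Proof.
by move=> /asboolP /(@maxset_exists _ (fun F => `[< plane_graph F >]))[E mE FE]; exists E.
Qed.

(** In a maximal plane graph, an edge can be missing only for one of two
    reasons, a vertex on it or an edge across it. *)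
Lemma maximal_plane_graph_edge E i j : maximal_plane_graph E -> i != j ->
  (forall k, ~ through i j k) ->
  (forall k l, (k, l) \in E -> crosses i j k l ->
     (k, l) = (i, j) \/ (k, l) = (j, i)) ->
  (i, j) \in E.
Proof.
move=> /maxsetP[/asboolP[Esym Eirr Eth Emt] Emax] ij nth nmt.
suff <- : ((i, j) |: ((j, i) |: E))%SET = E by rewrite !inE eqxx.
apply: Emax; last by apply/fintype.subsetP => e eE; rewrite !inE eE !orbT.
apply/asboolP; split.
- move=> k l; rewrite !inE !xpair_eqE.
  by case/or3P => [/andP[-> ->]|/andP[-> ->]|/Esym ->]; rewrite ?orbT.
- move=> k l; rewrite !inE !xpair_eqE.
  case/or3P => [/andP[/eqP -> /eqP ->]|/andP[/eqP -> /eqP ->]|/Eirr //] //.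
  by rewrite eq_sym.
- move=> k l m; rewrite !inE !xpair_eqE.
  case/or3P => [/andP[/eqP -> /eqP ->]|/andP[/eqP -> /eqP ->]|/Eth] //.
  by move=> /through_sym; apply: nth.
move=> i' j' k l; rewrite !inE !xpair_eqE.
case/or3P => [/andP[/eqP -> /eqP ->]|/andP[/eqP -> /eqP ->]|ijE];
  (case/or3P => [/andP[/eqP -> /eqP ->]|/andP[/eqP -> /eqP ->]|klE]) => mt.
- by left.
- by right.
- exact: nmt.
- by right.
- by left.
- by case: (nmt _ _ klE (crosses_flip mt)); [right|left].
- by case: (nmt _ _ ijE (crosses_sym mt)) => -[-> ->]; [left|right].
- by case: (nmt _ _ ijE (crosses_flip (crosses_sym mt))) => -[-> ->]; [right|left].
- exact: Emt mt.
Qed.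

Definition orientation (i j k : T) : R :=
  (x j - x i) * (y k - y i) - (y j - y i) * (x k - x i).

(** The coefficient of [b] when [w] is written as an affine combination of
    [a], [b], [c]; the coefficient of [c] is then [barycentric a c b w]. *)
Definition barycentric (a b c w : T) : R := orientation a w c / orientation a b c.

Lemma orientC a b c : orientation a c b = - orientation a b c.
Proof. rewrite /orientation; ring. Qed.

Lemma bary_x a b c w : orientation a b c != 0 ->
  x w = x a + barycentric a b c w * (x b - x a) + barycentric a c b w * (x c - x a).
Proof.
move=> d; rewrite /barycentric (orientC a b c) invrN mulrN.
apply: (mulfI d); rewrite !mulrDr.
rewrite /orientation in d *; field; exact: d.
Qed.

Lemma bary_y a b c w : orientation a b c != 0 ->
  y w = y a + barycentric a b c w * (y b - y a) + barycentric a c b w * (y c - y a).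
Proof.
move=> d; rewrite /barycentric (orientC a b c) invrN mulrN.
apply: (mulfI d); rewrite !mulrDr.
rewrite /orientation in d *; field; exact: d.
Qed.

Section Cone.
Variables (E : {set T * T}) (a : T).
Hypothesis plE : plane_graph E.

Definition empty_cone (b c : T) := forall d, (a, d) \in E ->
  ~ (0 < barycentric a b c d /\ 0 < barycentric a c b d).

(** An edge [PQ] runs through the point z of the open cone at [a] spanned by
    [b] and [c], with coordinates [zb] and [zc], and heads for a point [Q] that is
    nearer to [a] than the line [bc].  If it leaves the cone through
    the ray [ac], it must cross the edge [ac] itself. *)
Lemma exit_side b c P Q s : orientation a b c != 0 -> (a, c) \in E ->
  (P, Q) \in E -> 0 < s -> s < 1 ->
  let zb := barycentric a b c P + s * (barycentric a b c Q - barycentric a b c P) in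
  let zc := barycentric a c b P + s * (barycentric a c b Q - barycentric a c b P) in
  0 < zb -> 0 < zc -> zb + zc <= 1 ->
  barycentric a b c Q + barycentric a c b Q < 1 ->
  zc * barycentric a b c Q < zb * barycentric a c b Q -> barycentric a b c Q < 0 ->
  False.
Proof.
move=> D acE PQE s0 s1.
have [_ _ _ Emt] := plE.
set QB := barycentric a b c Q; set QC := barycentric a c b Q.
set PB := barycentric a b c P; set PC := barycentric a c b P.
move=> zb zc zb0 zc0 zbc lamQ out Qb.
have den : 0 < zb - QB by lra.
pose t := zb / (zb - QB).
have tden : t * (zb - QB) = zb by rewrite /t divfK // gt_eqF.
have t0 : 0 < t by apply: divr_gt0.
have t1 : t < 1 by rewrite ltr_pdivrMr // mul1r; lra.
pose s' := s + t * (1 - s).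
have g1 : (1 - t) * zb + t * QB = 0 by nra.
pose g := (1 - t) * zc + t * QC.
have gE : g * (zb - QB) = zb * QC - zc * QB.
  have -> : g * (zb - QB) = zc * (zb - QB) + (t * (zb - QB)) * (QC - zc) by rewrite /g; ring.
  rewrite tden; ring.
have g0 : 0 < g by rewrite -(pmulr_lgt0 _ den) gE subr_gt0.
have glt1 : g < 1.
  have : g + ((1 - t) * zb + t * QB) = (1 - t) * (zb + zc) + t * (QB + QC) by rewrite /g; ring.
  rewrite g1 addr0 => ->; nra.
have eB : PB + s' * (QB - PB) = 0 by rewrite -[RHS]g1 /s' /zb; ring.
have eC : PC + s' * (QC - PC) = g by rewrite /s' /g /zc; ring.
have mt : crosses P Q a c.
  exists s', g; split.
  - rewrite /s'; nra.
  - by rewrite g0 glt1.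
  - rewrite (bary_x P D) (bary_x Q D) -/PB -/PC -/QB -/QC.
    transitivity (x a + (PB + s' * (QB - PB)) * (x b - x a)
                  + (PC + s' * (QC - PC)) * (x c - x a)); first ring.
    by rewrite eB eC mul0r addr0.
  - rewrite (bary_y P D) (bary_y Q D) -/PB -/PC -/QB -/QC.
    transitivity (y a + (PB + s' * (QB - PB)) * (y b - y a)
                  + (PC + s' * (QC - PC)) * (y c - y a)); first ring.
    by rewrite eB eC mul0r addr0.
have c0 : barycentric a b c c = 0 by rewrite /barycentric /orientation; ring.
have a0 : barycentric a b c a = 0 by rewrite /barycentric /orientation; ring.
have [[eP eQ]|[eP eQ]] := Emt _ _ _ _ PQE acE mt.
  by move: Qb; rewrite /QB -eQ c0 ltxx.
by move: Qb; rewrite /QB -eP a0 ltxx.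
Qed.

(** If [Q] lies outside the cone, the edge leaves the cone through the ray [ac]
    or through the ray [ab], or else reaches the apex [a].  That near to
    [a], the rays are covered by the edges [ac] and [ab]; and an edge that reaches
    [a] either passes through a vertex or comes from a neighbour of [a] inside the
    cone. *)
Lemma no_edge_into_cone b c P Q s : orientation a b c != 0 ->
  (a, b) \in E -> (a, c) \in E -> empty_cone b c ->
  (P, Q) \in E -> 0 < s -> s < 1 ->
  let zb := barycentric a b c P + s * (barycentric a b c Q - barycentric a b c P) in
  let zc := barycentric a c b P + s * (barycentric a c b Q - barycentric a c b P) in
  0 < zb -> 0 < zc -> zb + zc <= 1 ->
  barycentric a b c Q + barycentric a c b Q < 1 ->
  ~ (0 < barycentric a b c Q /\ 0 < barycentric a c b Q) ->
  False.
Proof.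
move=> D abE acE cone PQE s0 s1 zb zc zb0 zc0 zbc lamQ notin.
have [Esym _ Eth _] := plE.
have D' : orientation a c b != 0 by rewrite orientC oppr_eq0.
have [lt|gt|eq] := ltgtP (zc * barycentric a b c Q) (zb * barycentric a c b Q).
- have [neg|nneg] := ltP (barycentric a b c Q) 0.
    exact: (exit_side D acE PQE s0 s1 zb0 zc0 zbc lamQ lt neg).
  have cpos : 0 < barycentric a c b Q.
    have : 0 <= zc * barycentric a b c Q by rewrite mulr_ge0 // ltW.
    by move=> /le_lt_trans /(_ lt); rewrite pmulr_rgt0.
  have b0 : barycentric a b c Q = 0.
    apply/eqP; rewrite eq_le nneg andbT leNgt; apply/negP => bpos.
    exact: notin.
  apply: (Eth _ _ Q acE); exists (barycentric a c b Q); split=> //.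
  - by move: lamQ; rewrite b0 add0r.
  - by rewrite [LHS](bary_x Q D) b0 mul0r addr0.
  - by rewrite [LHS](bary_y Q D) b0 mul0r addr0.
- have [neg|nneg] := ltP (barycentric a c b Q) 0.
    apply: (exit_side D' abE PQE s0 s1 zc0 zb0 _ _ gt neg); first by rewrite addrC.
    by rewrite addrC.
  have cpos : 0 < barycentric a b c Q.
    have : 0 <= zb * barycentric a c b Q by rewrite mulr_ge0 // ltW.
    by move=> /le_lt_trans /(_ gt); rewrite pmulr_rgt0.
  have b0 : barycentric a c b Q = 0.
    apply/eqP; rewrite eq_le nneg andbT leNgt; apply/negP => bpos.
    exact: notin.
  apply: (Eth _ _ Q abE); exists (barycentric a b c Q); split=> //.
  - by move: lamQ; rewrite b0 addr0.
  - by rewrite [LHS](bary_x Q D) b0 mul0r addr0.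
  - by rewrite [LHS](bary_y Q D) b0 mul0r addr0.
have [neg|pos|b0] := ltgtP (barycentric a b c Q) 0.
(* The two ratios agree: the segment hits the apex. *)
- have den : 0 < zb - barycentric a b c Q by lra.
  pose t := zb / (zb - barycentric a b c Q).
  have tden : t * (zb - barycentric a b c Q) = zb by rewrite /t divfK // gt_eqF.
  have t0 : 0 < t by apply: divr_gt0.
  have t1 : t < 1 by rewrite ltr_pdivrMr // mul1r; lra.
  pose s' := s + t * (1 - s).
  have g1 : (1 - t) * zb + t * barycentric a b c Q = 0 by nra.
  have g2 : (1 - t) * zc + t * barycentric a c b Q = 0.
    apply: (mulfI (lt0r_neq0 zb0)); rewrite mulr0 -(mulr0 zc) -g1.
    have -> : zb * ((1 - t) * zc + t * barycentric a c b Q) =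
        (1 - t) * (zb * zc) + t * (zb * barycentric a c b Q) by ring.
    rewrite -eq; ring.
  apply: (Eth _ _ a PQE); exists s'; split; rewrite ?/s'; try nra.
    rewrite [x P](bary_x P D) [x Q](bary_x Q D) -/s'.
    transitivity (x a + ((1 - t) * zb + t * barycentric a b c Q) * (x b - x a)
                  + ((1 - t) * zc + t * barycentric a c b Q) * (x c - x a)).
      by rewrite g1 g2 !mul0r !addr0.
    rewrite /zb /zc /s'; ring.
  rewrite [y P](bary_y P D) [y Q](bary_y Q D) -/s'.
  transitivity (y a + ((1 - t) * zb + t * barycentric a b c Q) * (y b - y a)
                + ((1 - t) * zc + t * barycentric a c b Q) * (y c - y a)).
    by rewrite g1 g2 !mul0r !addr0.
  rewrite /zb /zc /s'; ring.
- apply: notin; split=> //.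
  by rewrite -(pmulr_rgt0 _ zb0) -eq mulr_gt0.
have c0 : barycentric a c b Q = 0.
  by apply/eqP; move/eqP: eq; rewrite b0 mulr0 eq_sym mulf_eq0 gt_eqF.
have Qa : Q = a.
  by apply: xinj; rewrite [LHS](bary_x Q D) b0 c0 !mul0r !addr0.
apply: (cone P); first by rewrite -Qa; apply: Esym.
move: zb0 zc0; rewrite /zb /zc b0 c0 => h1 h2; split.
  by nra.
by nra.
Qed.

End Cone.
End PlaneGraphs.

(** * Consecutive edges of a maximal plane graph bound an empty triangle *)
Section EmptyTriangle.
Variables (R : realFieldType) (T : finType) (x y : T -> R).
Hypothesis xinj : injective x.
Variables (E : {set T * T}).
Hypothesis mxE : maximal_plane_graph x y E.

Let plE : plane_graph x y E.
Proof. by have /maxsetP[/asboolP] := mxE. Qed.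

Local Notation bary := (barycentric x y).
Local Notation orient := (orientation x y).

Lemma bary_affine a b c i j k s : 
  x k = x i + s * (x j - x i) -> y k = y i + s * (y j - y i) ->
  bary a b c k = bary a b c i + s * (bary a b c j - bary a b c i).
Proof. by move=> hx hy; rewrite /barycentric /orientation hx hy; ring. Qed.

Lemma bary_meet a b c i j k l s t :
  x i + s * (x j - x i) = x k + t * (x l - x k) ->
  y i + s * (y j - y i) = y k + t * (y l - y k) ->
  bary a b c i + s * (bary a b c j - bary a b c i) =
  bary a b c k + t * (bary a b c l - bary a b c k).
Proof.
move=> hx hy; rewrite /barycentric /orientation -!mulrBl !mulrA -!mulrDl.
congr (_ / _).
transitivity ((x i + s * (x j - x i) - x a) * (y c - y a)
  - (y i + s * (y j - y i) - y a) * (x c - x a)); first ring.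
rewrite hx hy; ring.
Qed.

Lemma bary0 a b c : bary a b c a = 0.
Proof. by rewrite /barycentric /orientation; ring. Qed.

Lemma baryc a b c : bary a b c c = 0.
Proof. by rewrite /barycentric /orientation; ring. Qed.

Lemma baryb a b c : orient a b c != 0 -> bary a b c b = 1.
Proof. by move=> d; rewrite /barycentric divff. Qed.

(** If the triangle contained vertices of the open cone, take one, q0, that is
    nearest to [a] in the direction transverse to [bc].  An edge across the
    segment from [a] to q0 would have an endpoint even nearer to [a], so that
    segment belongs to the maximal graph, against the emptiness of the
    cone. *)
Lemma cone_vertex_far a b c q : orient a b c != 0 ->
  (a, b) \in E -> (a, c) \in E -> empty_cone x y E a b c ->
  0 < bary a b c q -> 0 < bary a c b q -> 1 < bary a b c q + bary a c b q.
Proof.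
move=> D abE acE cone qb qc; rewrite ltNge; apply/negP => lam1.
have D' : orient a c b != 0 by rewrite orientC oppr_eq0.
pose inc w := (0 < bary a b c w) && (0 < bary a c b w).
pose lam w := bary a b c w + bary a c b w.
have q_in : inc q by rewrite /inc qb qc.
case: (Order.TotalTheory.arg_minP lam q_in) => q0 /andP[q0b q0c] q0min.
have lam0 : lam q0 <= 1 by apply: le_trans (q0min _ q_in) lam1.
have lam0p : 0 < lam q0 by apply: addr_gt0.
suff: (a, q0) \in E by move/cone; apply.
apply: (maximal_plane_graph_edge mxE).
- by apply: contraTneq q0b => <-; rewrite bary0 ltxx.
- move=> k [s [s0 s1 hx hy]].
  have kb := bary_affine a b c hx hy; have kc := bary_affine a c b hx hy.
  rewrite !bary0 !subr0 !add0r in kb kc.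
  have k_in : inc k by apply/andP; split; rewrite ?kb ?kc; apply: mulr_gt0.
  have := q0min k k_in; rewrite /lam kb kc -mulrDr -/(lam q0).
  by rewrite leNgt gtr_pMl // s1.
move=> P Q PQE [t [s [/andP[t0 t1] /andP[s0 s1] hx hy]]]; exfalso.
have zb := bary_meet a b c hx hy; have zc := bary_meet a c b hx hy.
rewrite !bary0 !subr0 !add0r in zb zc.
(* Along the crossing edge, the distance to [a] does not increase in one of
   the two directions. *)
have key P' Q' s' : (P', Q') \in E -> 0 < s' -> s' < 1 ->
   t * bary a b c q0 = bary a b c P' + s' * (bary a b c Q' - bary a b c P') ->
   t * bary a c b q0 = bary a c b P' + s' * (bary a c b Q' - bary a c b P') ->
   lam Q' <= t * lam q0 -> False.
  move=> PQE' s0' s1' eb ec le.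
  have lt : t * lam q0 < lam q0 by rewrite gtr_pMl.
  apply: (no_edge_into_cone xinj plE D abE acE cone PQE' s0' s1').
  - by rewrite -eb mulr_gt0.
  - by rewrite -ec mulr_gt0.
  - rewrite -eb -ec -mulrDr; apply: le_trans (ltW lt) lam0.
  - by apply: le_lt_trans le _; apply: lt_le_trans lt lam0.
  - move=> /andP in_Q; have := q0min _ in_Q; rewrite leNgt => /negP; apply.
    exact: le_lt_trans le lt.
have [PQsym _ _ _] := plE.
have zlam : t * lam q0 = lam P + s * (lam Q - lam P).
  by rewrite /lam mulrDr zb zc; ring.
have [leQ|ltQ] := leP (lam Q) (t * lam q0).
  exact: (key P Q s).
apply: (key Q P (1 - s) (PQsym _ _ PQE)); [lra|lra| | |].
- by rewrite zb; ring.
- by rewrite zc; ring.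
- by nra.
Qed.

(** Nothing obstructs [bc]: an edge across it would have to end inside the
    triangle, which is empty, or leave it through a side at [a]. *)
Lemma consecutive_edge a b c : orient a b c != 0 ->
  (a, b) \in E -> (a, c) \in E -> empty_cone x y E a b c -> (b, c) \in E.
Proof.
move=> D abE acE cone.
have D' : orient a c b != 0 by rewrite orientC oppr_eq0.
have far q := @cone_vertex_far a b c q D abE acE cone.
have bc : b != c.
  by apply: contraNneq D => ->; rewrite /orientation mulrC subrr.
have nth k : ~ through x y b c k.
  move=> [s [s0 s1 hx hy]].
  have kb := bary_affine a b c hx hy; have kc := bary_affine a c b hx hy.
  rewrite !baryc !baryb // in kb kc.
  have : 1 < bary a b c k + bary a c b k by apply: far; rewrite ?kb ?kc; lra.
  rewrite kb kc; lra.
apply: (maximal_plane_graph_edge mxE) => // P Q PQE.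
move=> [t [s [/andP[t0 t1] /andP[s0 s1] hx hy]]].
have zb := bary_meet a b c hx hy; have zc := bary_meet a c b hx hy.
rewrite !baryc !baryb // in zb zc.
have [PQsym _ PQth _] := plE.
pose lam w := bary a b c w + bary a c b w.
have key P' Q' s' : (P', Q') \in E -> 0 < s' -> s' < 1 ->
   1 - t = bary a b c P' + s' * (bary a b c Q' - bary a b c P') ->
   t = bary a c b P' + s' * (bary a c b Q' - bary a c b P') ->
   lam Q' < 1 -> False.
  move=> PQE' s0' s1' eb ec lt.
  apply: (no_edge_into_cone xinj plE D abE acE cone PQE' s0' s1').
  - by rewrite -eb subr_gt0.
  - by rewrite -ec.
  - by rewrite -eb -ec subrK.
  - exact: lt.
  - by move=> [Qb Qc]; have := far _ Qb Qc; rewrite ltNge (ltW lt).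
have [Qlt|Qge] := ltP (lam Q) 1.
  by case: (key P Q s PQE s0 s1); [rewrite -zb; ring|rewrite -zc; ring|].
have [Plt|Pge] := ltP (lam P) 1.
  case: (key Q P (1 - s) (PQsym _ _ PQE)); [lra|lra| | |exact: Plt].
  - have -> : 1 - t = 1 + t * (0 - 1) by ring.
    rewrite zb; ring.
  - have {1}-> : t = 0 + t * (1 - 0) by ring.
    rewrite zc; ring.
have [lamP lamQ] : lam P = 1 /\ lam Q = 1 by move: zb zc Pge Qge; rewrite /lam; nra.
have Pb : bary a b c P = 1 - bary a c b P by rewrite -lamP /lam addrK.
have Qb : bary a b c Q = 1 - bary a c b Q by rewrite -lamQ /lam addrK.
set u := bary a c b P in Pb zc *; set v := bary a c b Q in Qb zc *.
have {}zc : t = u + s * (v - u) by rewrite -zc; ring.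
have outside w : bary a b c w = 1 - bary a c b w ->
   bary a c b w <= 0 \/ 1 <= bary a c b w.
  move=> wb; have [|h0] := leP (bary a c b w) 0; first by left.
  have [|h1] := leP 1 (bary a c b w); first by right.
  have : 1 < bary a b c w + bary a c b w by apply: far; rewrite ?wb ?subr_gt0.
  by rewrite wb subrK ltxx.
have at_b w : bary a b c w = 1 - bary a c b w -> bary a c b w = 0 -> w = b.
  move=> wb wc; apply: xinj; rewrite (bary_x w D) wb wc; ring.
have at_c w : bary a b c w = 1 - bary a c b w -> bary a c b w = 1 -> w = c.
  move=> wb wc; apply: xinj; rewrite (bary_x w D) wb wc; ring.
(* From here on both endpoints lie on the line [bc]. *)
have passes k r : bary a b c k = 1 - bary a c b k -> 0 < r -> r < 1 ->
   bary a c b k = u + r * (v - u) -> False.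
  move=> kb r0 r1 kc; apply: (PQth _ _ k PQE); exists r; split=> //.
    rewrite (bary_x k D) (bary_x P D) (bary_x Q D) Pb Qb kb kc -/u -/v; ring.
  rewrite (bary_y k D) (bary_y P D) (bary_y Q D) Pb Qb kb kc -/u -/v; ring.
have bb : bary a b c b = 1 - bary a c b b by rewrite baryc baryb // subr0.
have cc : bary a b c c = 1 - bary a c b c by rewrite baryc baryb // subrr.
have between k : bary a b c k = 1 - bary a c b k ->
    (u < bary a c b k < v) || (v < bary a c b k < u) -> False.
  move=> kb uv; pose r := (bary a c b k - u) / (v - u).
  have pos : 0 < (bary a c b k - u) * (v - u) /\
      0 < (v - bary a c b k) * (v - u).
    case/orP: uv => /andP[h1 h2]; have h := lt_trans h1 h2.
      by rewrite !mulr_gt0 ?subr_gt0.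
    by rewrite !nmulr_rgt0 ?subr_lt0.
  have vu : v - u != 0 by apply: contraTneq pos.1 => ->; rewrite mulr0 ltxx.
  apply: (passes k r kb); last by rewrite /r divfK //; ring.
    exact: divr_gt0_mul pos.1.
  rewrite -subr_gt0; have -> : 1 - r = (v - bary a c b k) / (v - u).
    by rewrite /r; field.
  exact: divr_gt0_mul pos.2.
have ub := between b bb; have uc := between c cc.
rewrite baryc in ub; rewrite baryb // in uc.
have {}ub : ~ (u < 0 /\ 0 < v) /\ ~ (v < 0 /\ 0 < u).
  by split=> -[h1 h2]; apply: ub; rewrite h1 h2 ?orbT.
have {}uc : ~ (u < 1 /\ 1 < v) /\ ~ (v < 1 /\ 1 < u).
  by split=> -[h1 h2]; apply: uc; rewrite h1 h2 ?orbT.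
have [u0|u1] := outside P Pb; have [v0|v1] := outside Q Qb.
- by exfalso; rewrite -/u -/v in u0 v0; nra.
- rewrite -/u -/v in u0 v1.
  have eu : u = 0.
    apply/eqP; rewrite eq_le u0 leNgt; apply/negP => h; apply: ub.1; split=> //; lra.
  have ev : v = 1.
    apply/eqP; rewrite eq_le v1 andbT leNgt; apply/negP => h; apply: uc.1; split=> //; lra.
  by left; rewrite (at_b P) // (at_c Q).
- rewrite -/u -/v in u1 v0.
  have ev : v = 0.
    apply/eqP; rewrite eq_le v0 leNgt; apply/negP => h; apply: ub.2; split=> //; lra.
  have eu : u = 1.
    apply/eqP; rewrite eq_le u1 andbT leNgt; apply/negP => h; apply: uc.2; split=> //; lra.
  by right; rewrite (at_c P) // (at_b Q).
- by exfalso; rewrite -/u -/v in u1 v1; nra.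
Qed.

(** The triangle also occupies a whole corner at [b]: an edge from [b] into the
    angle between [ba] and [bc] would end inside the triangle or cross [ac]. *)
Lemma opposite_corner a b c d : orient a b c != 0 ->
  (a, b) \in E -> (a, c) \in E -> empty_cone x y E a b c -> (b, d) \in E ->
  0 < bary a c b d -> bary a b c d + bary a c b d < 1 -> False.
Proof.
move=> D abE acE cone bdE dc lam1.
have [Esym Eirr Eth Emt] := plE.
have [neg|pos|d0] := ltgtP (bary a b c d) 0.
- have den : 0 < 1 - bary a b c d by lra.
  pose t := (1 - bary a b c d)^-1.
  have tden : t * (1 - bary a b c d) = 1 by rewrite /t mulVf // gt_eqF.
  have t0 : 0 < t by rewrite invr_gt0.
  pose g := t * bary a c b d.
  have t1 : t < 1 by rewrite invf_lt1 //; lra.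
  have g1 : g < 1 by rewrite /g; nra.
  have mt : crosses x y b d a c.
    exists t, g; split.
    - by rewrite t0 t1.
    - by rewrite g1 mulr_gt0.
    - rewrite (bary_x d D).
      transitivity (x a + (1 - t * (1 - bary a b c d)) * (x b - x a) + g * (x c - x a)).
        by rewrite /g; ring.
      by rewrite tden subrr mul0r addr0.
    - rewrite (bary_y d D).
      transitivity (y a + (1 - t * (1 - bary a b c d)) * (y b - y a) + g * (y c - y a)).
        by rewrite /g; ring.
      by rewrite tden subrr mul0r addr0.
  have [[ab _]|[_ cb]] := Emt _ _ _ _ bdE acE mt.
    by have := Eirr _ _ abE; rewrite ab eqxx.
  by move: D; rewrite cb /orientation mulrC subrr eqxx.
- by have := cone_vertex_far D abE acE cone pos dc; rewrite ltNge (ltW lam1).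
apply: (Eth _ _ d acE); exists (bary a c b d); split=> //.
- by rewrite d0 add0r in lam1.
- by rewrite [LHS](bary_x d D) d0 mul0r addr0.
- by rewrite [LHS](bary_y d D) d0 mul0r addr0.
Qed.

End EmptyTriangle.

(** * Slopes and the corner at the middle vertex *)
Section Slots.
Variables (R : realFieldType) (T : finType) (x y : T -> R).
Hypothesis xinj : injective x.
Variables (E : {set T * T}).
Hypothesis mxE : maximal_plane_graph x y E.

Definition slope (i j : T) : R := (y j - y i) / (x j - x i).

Lemma slopeC i j : slope i j = slope j i.
Proof. by rewrite /slope -opprB -(opprB (x i)) invrN mulrNN. Qed.

Lemma slopeE i j : x j - x i != 0 -> y j - y i = slope i j * (x j - x i).
Proof. by move=> d; rewrite /slope divfK. Qed.

Lemma orient_slope i j k : x j - x i != 0 -> x k - x i != 0 ->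
  orientation x y i j k = (x j - x i) * (x k - x i) * (slope i k - slope i j).
Proof. by move=> dj dk; rewrite /orientation (slopeE dj) (slopeE dk); ring. Qed.

Lemma orient_rot i j k : orientation x y i j k = orientation x y j k i.
Proof. by rewrite /orientation; ring. Qed.

Lemma bary_sum a b c d : orientation x y a b c != 0 ->
  1 - barycentric x y a b c d - barycentric x y a c b d =
  orientation x y b c d / orientation x y a b c.
Proof.
move=> D; rewrite /barycentric (orientC x y a b c) invrN mulrN opprK.
apply: (mulIf D); rewrite mulrDl mulrBl mul1r !divfK //.
rewrite /orientation; ring.
Qed.

Lemma opposite_signs (e u v : R) : e * u < 0 -> 0 < e * v -> u * v < 0.
Proof.
move=> u0 v0; have e0 : e != 0 by apply: contraTneq v0 => ->; rewrite mul0r ltxx.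
rewrite -(pmulr_rlt0 _ (_ : 0 < e ^+ 2)) ?exprn_even_gt0 //.
have -> : e ^+ 2 * (u * v) = (e * u) * (e * v) by ring.
by rewrite pmulr_llt0.
Qed.

Lemma same_signs (e u v : R) : 0 < e * u -> 0 < e * v -> 0 < u * v.
Proof.
move=> u0 v0; rewrite -oppr_lt0 -mulNr; apply: (opposite_signs _ v0).
by rewrite mulrN oppr_lt0.
Qed.

(** Here [m] and [M] are neighbours of [a] on the same side, consecutive for the
    slope, and [m] is the one whose abscissa lies between the other two. *)
Section Consecutive.
Variables a m M : T.
Hypotheses (amE : (a, m) \in E) (aME : (a, M) \in E).
Hypotheses (between : 0 < (x m - x a) * (x M - x m)).
Hypothesis slope_neq : slope a m != slope a M.
Hypothesis consecutive : forall d, (a, d) \in E -> 0 < (x m - x a) * (x d - x a) ->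
  ~ (slope a m < slope a d < slope a M) /\ ~ (slope a M < slope a d < slope a m).

Let am0 : x m - x a != 0.
Proof. by apply: contraTneq between => ->; rewrite mul0r ltxx. Qed.

Let mM0 : x M - x m != 0.
Proof. by apply: contraTneq between => ->; rewrite mulr0 ltxx. Qed.

Let side : 0 < (x m - x a) * (x M - x a).
Proof. by move: between (sqr_ge0 (x m - x a)); nra. Qed.

Let aM0 : x M - x a != 0.
Proof. by apply: contraTneq side => ->; rewrite mulr0 ltxx. Qed.

Lemma triangle_nondegenerate : orientation x y a m M != 0.
Proof.
by rewrite orient_slope // !mulf_neq0 // subr_eq0 eq_sym.
Qed.

Lemma consecutive_empty_cone : empty_cone x y E a m M.
Proof.
move=> d adE [db dc].
have [Esym Eirr _ _] : plane_graph x y E by have /maxsetP[/asboolP] := mxE.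
have ad0 : x d - x a != 0.
  by apply: contra (Eirr _ _ adE); rewrite subr_eq0 => /eqP /xinj ->.
have nz : slope a M - slope a m != 0 by rewrite subr_eq0 eq_sym.
have nz' : slope a m - slope a M != 0 by rewrite subr_eq0.
have db' : barycentric x y a m M d =
   (x d - x a) / (x m - x a) * ((slope a M - slope a d) / (slope a M - slope a m)).
  rewrite /barycentric !orient_slope //; field; by rewrite ?nz ?nz' ?am0 ?aM0.
have dc' : barycentric x y a M m d =
   (x d - x a) / (x M - x a) * ((slope a d - slope a m) / (slope a M - slope a m)).
  rewrite /barycentric !orient_slope //; field; by rewrite ?nz ?nz' ?am0 ?aM0.
rewrite {}db' in db; rewrite {}dc' in dc.
set P := (_ - _) / (slope a M - slope a m) in db.
set Q := (_ - _) / (slope a M - slope a m) in dc.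
have PQ : P + Q = 1.
  by rewrite /P /Q; field.
have P1 : P * (slope a M - slope a m) = slope a M - slope a d by rewrite /P divfK.
have [pos|neg] := ltP 0 ((x m - x a) * (x d - x a)).
  have r1 : 0 < (x d - x a) / (x m - x a) by apply: divr_gt0_mul; rewrite mulrC.
  have r2 : 0 < (x d - x a) / (x M - x a).
    by apply: divr_gt0_mul; apply: (same_signs pos side).
  rewrite (pmulr_rgt0 _ r1) in db; rewrite (pmulr_rgt0 _ r2) in dc.
  have [h1 h2] := consecutive adE pos.
  have [lt|gt|eq] := ltgtP (slope a m) (slope a M).
  - by apply: h1; apply/andP; split; nra.
  - by apply: h2; apply/andP; split; nra.
  - by move/eqP: eq; rewrite (negbTE slope_neq).
have {}neg : 0 < (x m - x a) * - (x d - x a).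
  by rewrite mulrN oppr_gt0 lt_neqAle neg mulf_neq0.
have r1 : 0 < - (x d - x a) / (x m - x a) by apply: divr_gt0_mul; rewrite mulrC.
have r2 : 0 < - (x d - x a) / (x M - x a).
  by apply: divr_gt0_mul; apply: (same_signs neg side).
rewrite mulNr oppr_gt0 in r1; rewrite mulNr oppr_gt0 in r2.
rewrite (nmulr_rgt0 _ r1) in db; rewrite (nmulr_rgt0 _ r2) in dc.
lra.
Qed.

Lemma consecutive_far_edge : (m, M) \in E.
Proof.
exact: (consecutive_edge xinj mxE triangle_nondegenerate amE aME consecutive_empty_cone).
Qed.

Variable e : R.
Hypothesis e_slope : e * slope a m < e * slope a M.

Let mC : 0 < e * (slope m M - slope m a).
Proof.
have -> : slope m M - slope m a = (slope a M - slope a m) * ((x M - x a) / (x M - x m)).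
  have h1 := slopeE am0; have h2 := slopeE aM0.
  rewrite (slopeC m a) [slope m M]/slope.
  have -> : y M - y m = (y M - y a) - (y m - y a) by ring.
  by rewrite h1 h2; field.
rewrite mulrA mulr_gt0 //; first by rewrite mulrBr subr_gt0.
apply: divr_gt0_mul; move: between (sqr_ge0 (x M - x m)) side; nra.
Qed.

(** The triangle [a m M] lies entirely above or entirely below [m], so at the
    middle vertex [m] its sides are extreme: no edge at [m] lies between them
    and the vertical direction.  The factor [e] treats the two cases at
    once. *)
Lemma consecutive_near_corner d : (m, d) \in E ->
  (0 < (x a - x m) * (x d - x m) -> e * slope m a <= e * slope m d) /\
  (0 < (x M - x m) * (x d - x m) -> e * slope m d <= e * slope m M).
Proof.
move=> mdE; have D := triangle_nondegenerate.
have nz : slope m M - slope m a != 0.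
  by apply: contraTneq mC => ->; rewrite mulr0 ltxx.
have opp := @opposite_corner R T x y xinj E mxE a m M d D amE aME
  consecutive_empty_cone mdE.
have ma0 : x a - x m != 0 by rewrite -opprB oppr_eq0.
have lamE : barycentric x y a m M d + barycentric x y a M m d < 1 <->
    0 < orientation x y m M d / orientation x y a m M.
  by rewrite -(bary_sum d D) -subr_gt0 opprD addrA.
have AC : (x a - x m) * (x M - x m) < 0 by move: between; nra.
have A2 : 0 < (x a - x m) ^+ 2 by rewrite exprn_even_gt0.
have C2 : 0 < (x M - x m) ^+ 2 by rewrite exprn_even_gt0.
have reduce : x d - x m != 0 ->
    0 < ((x d - x m) * (x M - x m)) *
        ((slope m d - slope m a) * (slope m M - slope m a)) ->
    0 < ((x d - x m) * (x a - x m)) *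
        ((slope m d - slope m M) * (slope m a - slope m M)) -> False.
  move=> md0 h1 h2; apply: opp.
    rewrite /barycentric; apply: divr_gt0_mul.
    rewrite (orient_rot a d m) (orient_rot d m a) (orient_rot a M m) (orient_rot M m a).
    rewrite !orient_slope //.
    by move: (mulr_gt0 A2 h1); congr (0 < _); ring.
  apply/lamE; apply: divr_gt0_mul; rewrite (orient_rot a m M) !orient_slope //.
  by move: (mulr_gt0 C2 h2); congr (0 < _); ring.
split=> dside; rewrite leNgt; apply/negP => lt.
- have md0 : x d - x m != 0 by apply: contraTneq dside => ->; rewrite mulr0 ltxx.
  apply: (reduce md0).
    rewrite nmulr_lgt0; first by nra.
    by apply: opposite_signs mC; rewrite mulrBr subr_lt0.
  rewrite [(x d - _) * _]mulrC (pmulr_rgt0 _ dside).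
  apply: (@same_signs (- e)); rewrite mulNr -mulrN opprB mulrBr subr_gt0.
    by apply: lt_trans lt _; rewrite -subr_gt0 -mulrBr.
  by rewrite -subr_gt0 -mulrBr.
- have md0 : x d - x m != 0 by apply: contraTneq dside => ->; rewrite mulr0 ltxx.
  apply: (reduce md0).
    rewrite [(x d - _) * _]mulrC (pmulr_rgt0 _ dside).
    apply: (same_signs _ mC); rewrite mulrBr subr_gt0.
    by apply: lt_trans lt; rewrite -subr_gt0 -mulrBr.
  rewrite nmulr_lgt0; first by nra.
  rewrite mulrC; apply: (@opposite_signs e); last by rewrite mulrBr subr_gt0.
  by rewrite -opprB mulrN oppr_lt0.
Qed.

End Consecutive.
End Slots.

(** * The angular order at a vertex *)
Section Vertex.
Variables (R : rcfType) (T : finType) (x y : T -> R).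

Definition dist (i j : T) : R := Num.sqrt ((x j - x i) ^+ 2 + (y j - y i) ^+ 2).

(** Minus the half-angle tangent of the direction from [i] to [j], measured
    clockwise from the upward vertical: a rational parameter of the circle, in
    which the directions to the right come first, by increasing slope, and then
    those to the left, by increasing slope. *)
Definition angle_key (i j : T) : R := - (x j - x i) / (dist i j + (y j - y i)).

Lemma dist_sqr i j : dist i j ^+ 2 = (x j - x i) ^+ 2 + (y j - y i) ^+ 2.
Proof. by rewrite sqr_sqrtr // addr_ge0 // sqr_ge0. Qed.

Lemma distC i j : dist i j = dist j i.
Proof. by rewrite /dist -(opprB (x j)) -(opprB (y j)) !sqrrN. Qed.

Lemma dist_dy_gt0 i j : x j - x i != 0 -> 0 < dist i j + (y j - y i).
Proof.
move=> d; rewrite -ltrBlDr sub0r.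
have [h|h] := ltP (- (y j - y i)) 0; first by apply: lt_le_trans h (sqrtr_ge0 _).
rewrite -(ltr_pXn2r (ltn0Sn 1)) ?nnegrE ?sqrtr_ge0 //.
by rewrite sqrrN dist_sqr ltrDr exprn_even_gt0.
Qed.

Lemma angle_key_sqr i j : x j - x i != 0 ->
  (dist i j + (y j - y i)) * angle_key i j ^+ 2 = dist i j - (y j - y i).
Proof.
move=> d; have L := lt0r_neq0 (dist_dy_gt0 d).
apply: (mulfI L).
have -> : (dist i j + (y j - y i)) * (dist i j - (y j - y i)) = (x j - x i) ^+ 2.
  by rewrite mulrC -subr_sqr dist_sqr addrK.
rewrite /angle_key expr_div_n; field; exact: L.
Qed.

Lemma angle_key_gt0 i j : x j != x i -> (0 < angle_key i j) = (x j < x i).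
Proof.
rewrite -subr_eq0 => d; rewrite /angle_key pmulr_lgt0 ?invr_gt0 ?dist_dy_gt0 //.
by rewrite oppr_gt0 subr_lt0.
Qed.

Lemma angle_key_lt0 i j : x j != x i -> (angle_key i j < 0) = (x i < x j).
Proof.
rewrite -subr_eq0 => d; rewrite /angle_key pmulr_llt0 ?invr_gt0 ?dist_dy_gt0 //.
by rewrite oppr_lt0 subr_gt0.
Qed.

(** The slope is (k - 1/k)/2 in terms of the key k, an increasing function of k
    on each of the two half-lines. *)
Lemma angle_key_slope i j k : 0 < (x j - x i) * (x k - x i) ->
  (angle_key i j < angle_key i k) = (slope x y i j < slope x y i k).
Proof.
move=> side.
have dj : x j - x i != 0 by apply: contraTneq side => ->; rewrite mul0r ltxx.
have dk : x k - x i != 0 by apply: contraTneq side => ->; rewrite mulr0 ltxx.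
have slopeE l : x l - x i != 0 -> angle_key i l != 0 /\
    slope x y i l = (angle_key i l - (angle_key i l)^-1) / 2.
  move=> d; have L := lt0r_neq0 (dist_dy_gt0 d).
  have k0 : angle_key i l != 0 by rewrite mulf_neq0 ?oppr_eq0 ?invr_eq0.
  split=> //; apply: (mulfI k0).
  have -> : angle_key i l * ((angle_key i l - (angle_key i l)^-1) / 2) =
     (angle_key i l ^+ 2 - 1) / 2 by rewrite mulrA mulrBr divff.
  apply: (mulfI L); rewrite [RHS]mulrA mulrBr angle_key_sqr // /angle_key /slope.
  by field; rewrite L d.
have [kj ->] := slopeE j dj; have [kk ->] := slopeE k dk.
have pos : 0 < angle_key i j * angle_key i k.
  rewrite /angle_key mulrACA mulrNN mulr_gt0 //.
  by rewrite -invfM invr_gt0 mulr_gt0 // dist_dy_gt0.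
rewrite -[RHS]subr_gt0 -[LHS]subr_gt0.
have -> : (angle_key i k - (angle_key i k)^-1) / 2 - (angle_key i j - (angle_key i j)^-1) / 2
  = (angle_key i k - angle_key i j) * ((1 + (angle_key i j * angle_key i k)^-1) / 2).
  by field; rewrite kj kk.
rewrite pmulr_lgt0 // divr_gt0 // addr_gt0 // invr_gt0; exact: pos.
Qed.

(** With the weights w_i (d_i + dy_i), the moments of order 0, 1 and 2 of the key
    are the sums of w_i (d_i + dy_i), of -w_i dx_i and of w_i (d_i - dy_i), where
    d_i is the distance.  All three vanish by equilibrium. *)
Lemma equilibrium_changes (w : T -> R) (v : T) (c : T -> bool) (s : seq T) :
  uniq s -> sorted (fun i j => angle_key v i < angle_key v j) s ->
  (forall i, i \in s -> x i != x v) ->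
  (forall i, w i != 0 -> i \in s) ->
  (forall i, i \in s -> if c i then 0 <= w i else w i <= 0) ->
  (exists i, w i != 0) ->
  \sum_i w i * dist v i = 0 ->
  \sum_i w i * (x i - x v) = 0 ->
  \sum_i w i * (y i - y v) = 0 ->
  (2 < changes c s)%N.
Proof.
move=> us srt xs ws cs [i0 wi0] hd hx hy.
pose b i := w i * (dist v i + (y i - y v)).
have sumE (f : T -> R) : \sum_(i <- s) w i * f i = \sum_i w i * f i.
  rewrite big_uniq //= [RHS](bigID [in s]) /= [X in _ = _ + X]big1 ?addr0 //.
  move=> i /negP is_; have [->|/ws //] := eqVneq (w i) 0; exact: mul0r.
have dx i : i \in s -> x i - x v != 0 by move/xs; rewrite subr_eq0.
apply: (@moment_changes _ _ (angle_key v) c b).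
- exact: srt.
- move=> i is_; have L := dist_dy_gt0 (dx i is_).
  by have := cs i is_; case: (c i); rewrite /b ?pmulr_lge0 ?pmulr_lle0.
- exists i0; first exact: ws.
  by rewrite mulf_neq0 // gt_eqF // dist_dy_gt0 // dx // ws.
- rewrite /b sumE; under eq_bigr => i _ do rewrite mulrDr.
  by rewrite big_split /= hd hy addr0.
- rewrite big_seq; under eq_bigr => i is_.
    rewrite /b /angle_key -mulrA.
    have L := lt0r_neq0 (dist_dy_gt0 (dx i is_)).
    rewrite [X in w i * X]mulrC divfK // mulrN; over.
  rewrite -big_seq sumrN sumE hx oppr0 //.
- rewrite big_seq; under eq_bigr => i is_.
    rewrite /b -mulrA angle_key_sqr ?dx // mulrBr; over.
  rewrite -big_seq big_split /= sumrN !sumE hd hy oppr0 addr0 //.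
Qed.

End Vertex.

(** * Counting sign changes in a maximal plane graph *)
Section Counting.
Variables (R : rcfType) (T : finType) (x y : T -> R).
Hypothesis xinj : injective x.
Variables (E : {set T * T}).
Hypothesis mxE : maximal_plane_graph x y E.

Let plE : plane_graph x y E.
Proof. by have /maxsetP[/asboolP] := mxE. Qed.

Local Notation sl := (slope x y).
Local Notation key := (angle_key x y).

Lemma slope_neighbour_inj v i j : (v, i) \in E -> (v, j) \in E ->
  0 < (x i - x v) * (x j - x v) -> sl v i = sl v j -> i = j.
Proof.
move=> viE vjE side eq; have [Esym Eirr Eth _] := plE.
have di : x i - x v != 0 by apply: contraTneq side => ->; rewrite mul0r ltxx.
have dj : x j - x v != 0 by apply: contraTneq side => ->; rewrite mulr0 ltxx.
have yi := slopeE y di; have yj := slopeE y dj; rewrite -eq in yj.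
have aux k l : (v, k) \in E -> 0 < (x k - x v) * (x l - x v) ->
    x k - x v != 0 ->
    y k - y v = sl v i * (x k - x v) -> y l - y v = sl v i * (x l - x v) ->
    ~ (x l - x v) ^+ 2 < (x k - x v) * (x l - x v).
  move=> vkE kl dk yk yl lt; apply: (Eth _ _ l vkE).
  exists ((x l - x v) / (x k - x v)); split.
  - by apply: divr_gt0_mul; rewrite mulrC.
  - rewrite -subr_gt0.
    have -> : 1 - (x l - x v) / (x k - x v) = (x k - x l) / (x k - x v) by field.
    apply: divr_gt0_mul; move: lt kl (sqr_ge0 (x k - x l)); nra.
  - by rewrite divfK // addrC subrK.
  - by rewrite yk mulrCA divfK // -yl addrC subrK.
apply: xinj; have := aux i j viE side di yi yj.
have := aux j i vjE _ dj yj yi; rewrite mulrC => /(_ side) h1 h2.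
have [lt|gt|//] := ltgtP (x i) (x j); exfalso.
- by have [p|n] := ltP 0 (x j - x v); [apply: h1|apply: h2]; nra.
- by have [p|n] := ltP 0 (x j - x v); [apply: h2|apply: h1]; nra.
Qed.

Lemma neighbour_x v i : (v, i) \in E -> x i != x v.
Proof.
by move=> viE; have [_ Eirr _ _] := plE; apply: contra (Eirr _ _ viE) => /eqP /xinj ->.
Qed.

Lemma key_side v i j : (v, i) \in E -> (v, j) \in E ->
  (x v < x i) = (x v < x j) -> 0 < (x i - x v) * (x j - x v).
Proof.
move=> /neighbour_x xi /neighbour_x xj.
case: ltgtP xi => // hi _; case: ltgtP xj => // hj _ _.
- by rewrite mulr_gt0 // subr_gt0.
- by rewrite -mulrNN !opprB mulr_gt0 // subr_gt0.
Qed.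

Lemma key_neighbour_inj v i j : (v, i) \in E -> (v, j) \in E -> key v i = key v j -> i = j.
Proof.
move=> viE vjE eq.
have xi := neighbour_x viE; have xj := neighbour_x vjE.
have side : 0 < (x i - x v) * (x j - x v).
  by apply: key_side => //; rewrite -!(angle_key_lt0 y) // eq.
apply: (slope_neighbour_inj viE vjE side).
have side' : 0 < (x j - x v) * (x i - x v) by rewrite mulrC.
apply/eqP; rewrite eq_le !leNgt -!angle_key_slope //.
by rewrite eq ltxx.
Qed.

Definition neighbours v : seq T :=
  sort (fun i j => key v i <= key v j) (enum [set i | (v, i) \in E]).

Lemma mem_neighbours v i : (i \in neighbours v) = ((v, i) \in E).
Proof. by rewrite mem_sort mem_enum inE. Qed.

Lemma sorted_neighbours v : sorted (fun i j => key v i < key v j) (neighbours v).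
Proof.
have uq : uniq (neighbours v) by rewrite sort_uniq enum_uniq.
have: sorted (fun i j => key v i <= key v j) (neighbours v).
  by apply: sort_sorted => i j; apply: le_total.
have mE i : i \in neighbours v -> (v, i) \in E by rewrite mem_neighbours.
elim: (neighbours v) uq mE => [|a [|b s] IH] //= /andP[anin uq] mE /andP[ab srt].
apply/andP; split; last first.
  by apply: IH => // i is_; apply: mE; rewrite inE is_ orbT.
rewrite lt_neqAle ab andbT; apply: contra anin => /eqP eq.
have -> : a = b by apply: (key_neighbour_inj _ _ eq); apply: mE; rewrite !inE eqxx ?orbT.
by rewrite inE eqxx.
Qed.

Definition slot_sign (e : bool) : R := if e then 1 else -1.

(** A slot [((e, m), (l, r))] is the corner at the vertex [m] that contains the
    upward direction (if [e] is true) or the downward one (if [e] is false),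
    bounded by the edges to [l] on the left and to [r] on the right.  Only a
    vertex with neighbours on both sides has slots, one of each kind. *)
Definition slot (s : (bool * T) * (T * T)) : bool :=
  let: ((e, m), (l, r)) := s in
  [&& (m, l) \in E, (m, r) \in E, x l < x m, x m < x r &
    [forall d, ((m, d) \in E) ==>
       ((x d < x m) ==> (slot_sign e * sl m l <= slot_sign e * sl m d)) &&
       ((x m < x d) ==> (slot_sign e * sl m d <= slot_sign e * sl m r))]].

Definition slots := [set s | slot s].

Definition two_sided := [set m | [exists l, ((m, l) \in E) && (x l < x m)] &&
                                 [exists r, ((m, r) \in E) && (x m < x r)]].

Lemma slot_sign_neq0 e : slot_sign e != 0.
Proof. by case: e; rewrite /slot_sign ?oppr_eq0 oner_eq0. Qed.

Lemma card_slots : (#|slots| <= 2 * #|two_sided|)%N.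
Proof.
have inj : {in slots &, injective (fun s : (bool * T) * (T * T) => s.1)}.
  move=> [[e m] [l r]] [[e' m'] [l' r']]; rewrite !inE /=.
  move=> /and5P[ml mr lm rm /forallP h] /and5P[ml' mr' lm' rm' /forallP h'] [ee mm].
  rewrite -{}ee -{}mm in ml' mr' lm' rm' h' *.
  have eq_slope i j : slot_sign e * sl m i <= slot_sign e * sl m j ->
      slot_sign e * sl m j <= slot_sign e * sl m i -> sl m i = sl m j.
    move=> h1 h2; apply: (mulfI (slot_sign_neq0 e)); apply/eqP.
    by rewrite eq_le h1 h2.
  have /andP[/implyP hl /implyP hr] := implyP (h _) ml'.
  have /andP[/implyP hl1 /implyP hr1] := implyP (h _) mr'.
  have /andP[/implyP hl' /implyP hr'] := implyP (h' _) ml.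
  have /andP[/implyP hl1' /implyP hr1'] := implyP (h' _) mr.
  congr (_, (_, _)).
    apply: (slope_neighbour_inj ml ml'); last by apply: eq_slope; auto.
    by rewrite -mulrNN !opprB mulr_gt0 // subr_gt0.
  apply: (slope_neighbour_inj mr mr'); last by apply: eq_slope; auto.
  by rewrite mulr_gt0 // subr_gt0.
rewrite -(card_in_imset inj) -card_bool -cardsT -cardsX.
apply: subset_leq_card; apply/fintype.subsetP => _ /imsetP[[[e m] [l r]] sl ->] /=.
move: sl; rewrite !inE /= => /and5P[ml mr lm rm _].
by apply/andP; split; apply/existsP; [exists l; rewrite ml|exists r; rewrite mr].
Qed.

Variable col : T -> T -> bool.
Hypothesis colC : forall i j, col i j = col j i.

(** Disagreement of the colour at the three corners of the triangle [l m r].  The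
    pair [l], [r] has a colour even when it is not an edge. *)
Definition left_change (s : (bool * T) * (T * T)) := col s.2.1 s.1.2 != col s.2.1 s.2.2.
Definition right_change (s : (bool * T) * (T * T)) := col s.2.2 s.1.2 != col s.2.2 s.2.1.
Definition middle_change (s : (bool * T) * (T * T)) := col s.1.2 s.2.1 != col s.1.2 s.2.2.

(** Three colours among two values cannot be pairwise distinct. *)
Lemma slot_changes :
  (#|[set s in slots | left_change s]| + #|[set s in slots | right_change s]| +
   #|[set s in slots | middle_change s]| <= 2 * #|slots|)%N.
Proof.
have cardE (P : pred ((bool * T) * (T * T))) :
    #|[set s in slots | P s]| = (\sum_(s in slots) P s)%N.
  rewrite -sum1dep_card big_mkcondr /=; apply: eq_bigr => s _; by case: (P s).
rewrite !cardE -!big_split /= mulnC -sum_nat_const leq_sum // => -[[e m] [l r]] _.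
rewrite /left_change /right_change /middle_change /=.
rewrite (colC l m) (colC r m) (colC r l).
by case: (col m l) (col m r) (col l r) => [] [] [].
Qed.

Definition corner_changes v : {set T * T} :=
  [set e : T * T | adjacent (key v) [in neighbours v] e.1 e.2 && (col v e.1 != col v e.2)].

Definition same_side v (e : T * T) : bool := (x v < x e.1) == (x v < x e.2).

Lemma changes_leq_corner v : (changes (col v) (neighbours v) <= #|corner_changes v|)%N.
Proof. exact: changes_leq_adjacent (sorted_neighbours v). Qed.

Lemma adjacentP v b c : adjacent (key v) [in neighbours v] b c ->
  [/\ (v, b) \in E, (v, c) \in E, key v b < key v c &
      forall d, (v, d) \in E -> ~ (key v b < key v d < key v c)].
Proof.
case/and4P => vb vc bc /forallP h; split=> //.
- by rewrite -mem_neighbours; exact: vb.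
- by rewrite -mem_neighbours; exact: vc.
move=> d vd; apply/negP; apply: (implyP (h d)).
by rewrite -mem_neighbours in vd; exact: vd.
Qed.

(** A corner at [a] between consecutive edges on the same side belongs to a
    triangle, and that triangle fills a slot at its middle vertex. *)
Lemma corner_slot a m M (e : bool) : (a, m) \in E -> (a, M) \in E ->
  0 < (x m - x a) * (x M - x m) -> slot_sign e * sl a m < slot_sign e * sl a M ->
  (forall d, (a, d) \in E -> 0 < (x m - x a) * (x d - x a) ->
  ~ (sl a m < sl a d < sl a M) /\ ~ (sl a M < sl a d < sl a m)) ->
  if x a < x m then slot ((e, m), (a, M)) else slot ((~~ e, m), (M, a)).
Proof.
move=> am aM btw es cons; have [Esym _ _ _] := plE.
have sneq : sl a m != sl a M.
  by apply: contraTneq es => ->; rewrite ltxx.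
have mM := consecutive_far_edge xinj mxE am aM btw sneq cons.
have near := consecutive_near_corner xinj mxE am aM btw sneq cons es.
have ma := Esym _ _ am.
have opp : slot_sign (~~ e) = - slot_sign e by case: (e); rewrite /slot_sign ?opprK.
have [lt|ge] := ltP (x a) (x m).
  have mM_lt : x m < x M by move: btw; rewrite pmulr_rgt0 ?subr_gt0.
  rewrite /slot ma mM lt mM_lt /=; apply/forallP => d; apply/implyP => md.
  have [h1 h2] := near d md.
  apply/andP; split; apply/implyP => dm; [apply: h1|apply: h2].
    by rewrite -mulrNN !opprB mulr_gt0 // subr_gt0.
  by rewrite mulr_gt0 // subr_gt0.
have gt : x m < x a by rewrite lt_neqAle ge andbT (neighbour_x am).
have mM_lt : x M < x m.
  by move: btw; rewrite nmulr_rgt0 ?subr_lt0.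
rewrite /slot ma mM gt mM_lt /=; apply/forallP => d; apply/implyP => md.
have [h1 h2] := near d md; rewrite opp !mulNr !lerN2.
apply/andP; split; apply/implyP => dm; [apply: h2|apply: h1].
  by rewrite -mulrNN !opprB mulr_gt0 // subr_gt0.
by rewrite mulr_gt0 // subr_gt0.
Qed.

(** The corner at the left vertex of the triangle of a slot, with its two edges
    listed by increasing slope. *)
Definition left_corner (s : (bool * T) * (T * T)) : T * (T * T) :=
  let: ((e, m), (l, r)) := s in (l, if e then (m, r) else (r, m)).

Definition right_corner (s : (bool * T) * (T * T)) : T * (T * T) :=
  let: ((e, m), (l, r)) := s in (r, if e then (l, m) else (m, l)).

(** The triangle of a corner determines that corner, since a triangle has only
    one leftmost vertex, only one rightmost vertex and only one middle one. *)
Lemma same_side_corners :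
  (#|[set t : T * (T * T) | (t.2 \in corner_changes t.1) && same_side t.1 t.2]| <=
   #|[set s in slots | left_change s]| + #|[set s in slots | right_change s]|)%N.
Proof.
apply: leq_trans (leq_add (leq_imset_card left_corner _) (leq_imset_card right_corner _)).
apply: leq_trans (leq_card_setU _ _).
apply: subset_leq_card; apply/fintype.subsetP => -[a [b c]]; rewrite !inE /=.
move=> /andP[/andP[/adjacentP[ab ac kbc cons] cc] /eqP side]; rewrite /= in side.
have side0 := key_side ab ac side.
have slt : sl a b < sl a c by rewrite -angle_key_slope.
have cons' d : (a, d) \in E -> 0 < (x b - x a) * (x d - x a) ->
    ~ (sl a b < sl a d < sl a c).
  move=> ad sd; rewrite -!angle_key_slope //; first exact: cons.
  by apply: (same_signs sd side0).
have cons_c d : (a, d) \in E -> 0 < (x c - x a) * (x d - x a) ->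
    ~ (sl a b < sl a d < sl a c).
  move=> ad sd; apply: cons' => //.
  by apply: (@same_signs _ (x c - x a)) => //; rewrite mulrC.
have bnc : x b != x c.
  by apply/eqP => /xinj bc; rewrite bc ltxx in kbc.
have xb := neighbour_x ab; have xc := neighbour_x ac.
(* The middle vertex of the triangle is [b] or [c]. *)
have [near_b|near_c] := ltP 0 ((x b - x a) * (x c - x b)).
  have := @corner_slot a b c true ab ac near_b.
  rewrite /slot_sign !mul1r => /(_ slt) h.
  have {h} : if x a < x b then slot (true, b, (a, c)) else slot (~~ true, b, (c, a)).
    apply: h => d ad sd; split; first exact: cons'.
    by move=> /andP[h1 h2]; have := lt_trans slt (lt_trans h1 h2); rewrite ltxx.
  have [lt|ge] := ltP (x a) (x b) => sl; apply/orP; [left|right]; apply/imsetP.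
    exists (true, b, (a, c)) => //; rewrite inE inE sl /left_change /=; exact: cc.
  exists (false, b, (c, a)) => //; rewrite inE inE sl /right_change /=; exact: cc.
have {}near_c : 0 < (x c - x a) * (x b - x c).
  have : (x b - x c) ^+ 2 > 0 by rewrite exprn_even_gt0 // subr_eq0.
  have h : (x b - x a) * (x c - x b) < 0.
    by rewrite lt_neqAle near_c mulf_neq0 // subr_eq0 // eq_sym.
  move: h side0.
  have [p|n] := ltP 0 (x b - x a).
    by rewrite pmulr_rlt0 // pmulr_rgt0 // => h1 h2 _; rewrite mulr_gt0 //; lra.
  have {}n : x b - x a < 0 by rewrite lt_neqAle n subr_eq0 xb.
  rewrite nmulr_rlt0 // nmulr_rgt0 // => h1 h2 _.
  by rewrite -mulrNN mulr_gt0 //; lra.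
have := @corner_slot a c b false ac ab near_c.
rewrite /slot_sign !mulN1r ltrN2 => /(_ slt) h.
have {h} : if x a < x c then slot (false, c, (a, b)) else slot (~~ false, c, (b, a)).
  apply: h => d ad sd; split; last exact: cons_c.
  by move=> /andP[h1 h2]; have := lt_trans slt (lt_trans h1 h2); rewrite ltxx.
have [lt|ge] := ltP (x a) (x c) => sl; apply/orP; [left|right]; apply/imsetP.
  exists (false, c, (a, b)) => //; rewrite inE inE sl /left_change /= eq_sym; exact: cc.
exists (true, c, (b, a)) => //; rewrite inE inE sl /right_change /= eq_sym; exact: cc.
Qed.

Definition top_corner (s : (bool * T) * (T * T)) : T * (T * T) :=
  let: ((e, m), (l, r)) := s in (m, (r, l)).

Lemma key_same_side v i j : (v, i) \in E -> (v, j) \in E ->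
  (x v < x i) = (x v < x j) -> (key v i < key v j) = (sl v i < sl v j).
Proof. by move=> vi vj side; rewrite angle_key_slope // key_side. Qed.

(** In the linear order of the key, the only adjacent edges on different sides are
    the two that bound the upward corner. *)
Lemma cross_corners :
  (#|[set t : T * (T * T) | (t.2 \in corner_changes t.1) && ~~ same_side t.1 t.2]| <=
   #|[set s in [set s in slots | middle_change s] | s.1.1]|)%N.
Proof.
apply: leq_trans (leq_imset_card top_corner _).
apply: subset_leq_card; apply/fintype.subsetP => -[v [b c]]; rewrite !inE /=.
move=> /andP[/andP[/adjacentP[vb vc kbc cons] cc] side]; rewrite /same_side /= in side cc.
have xb := neighbour_x vb; have xc := neighbour_x vc.
have [vb_lt cv_lt] : x v < x b /\ x c < x v.
  move: side; case: (ltgtP (x v) (x b)) xb => // hb _;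
    case: (ltgtP (x v) (x c)) xc => // hc _ _.
  have h1 : 0 < key v b by rewrite angle_key_gt0 // lt_eqF.
  have h2 : key v c < 0 by rewrite angle_key_lt0 // gt_eqF.
  by have := lt_trans kbc (lt_trans h2 h1); rewrite ltxx.
apply/imsetP; exists (true, v, (c, b)) => //.
rewrite !inE /middle_change /= eq_sym cc !andbT vb vc vb_lt cv_lt /=.
have kb : key v b < 0 by rewrite angle_key_lt0.
have kc : 0 < key v c by rewrite angle_key_gt0.
apply/forallP => d; apply/implyP => vd; rewrite !mul1r.
have xd := neighbour_x vd.
apply/andP; split; apply/implyP => dv; rewrite leNgt -key_same_side //.
- by apply/negP => h; apply: (cons d vd); rewrite h (lt_trans kb) // angle_key_gt0.
- by rewrite !ltNge !ltW.
- by apply/negP => h; apply: (cons d vd); rewrite h (lt_trans _ kc) // angle_key_lt0.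
- by rewrite vb_lt dv.
Qed.

(** The downward corner is the one that the linear order of the key cuts
    open, so a colour change there has to be counted apart. *)
Definition bottom_change := [set v | [exists e : T * T,
  slot ((false, v), e) && middle_change ((false, v), e)]].

Lemma card_bottom_change :
  (#|bottom_change| <= #|[set s in [set s in slots | middle_change s] | ~~ s.1.1]|)%N.
Proof.
apply: leq_trans (leq_imset_card (fun s : (bool * T) * (T * T) => s.1.2) _).
apply: subset_leq_card; apply/fintype.subsetP => v; rewrite inE => /existsP[e /andP[sl mc]].
by apply/imsetP; exists ((false, v), e) => //; rewrite !inE andbT mc andbT.
Qed.

Lemma corner_upper_bound :
  (\sum_v (#|corner_changes v| + (v \in bottom_change)) <= 4 * #|two_sided|)%N.
Proof.
rewrite big_split /= [X in (_ + X)%N](_ : _ = #|bottom_change|); last first.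
  by rewrite -sum1_card [RHS]big_mkcond /=; apply: eq_bigr => v _; case: (v \in _).
have -> : (\sum_v #|corner_changes v| =
    #|[set t : T * (T * T) | t.2 \in corner_changes t.1]|)%N.
  rewrite -sum1dep_card.
  rewrite -(pair_big_dep xpredT (fun v e => e \in corner_changes v) (fun _ _ => 1%N)) /=.
  by apply: eq_bigr => v _; rewrite sum1_card.
rewrite -(cardsID [set t : T * (T * T) | same_side t.1 t.2]).
have -> : [set t : T * (T * T) | t.2 \in corner_changes t.1] :&:
    [set t | same_side t.1 t.2]
   = [set t | (t.2 \in corner_changes t.1) && same_side t.1 t.2].
  by apply/finset.setP => t; rewrite !inE.
have -> : [set t : T * (T * T) | t.2 \in corner_changes t.1] :\:
    [set t | same_side t.1 t.2]
   = [set t | (t.2 \in corner_changes t.1) && ~~ same_side t.1 t.2].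
  by apply/finset.setP => t; rewrite !inE andbC.
apply: leq_trans (leq_add (leq_add same_side_corners cross_corners) card_bottom_change) _.
rewrite -addnA.
have -> : (#|[set s in [set s in slots | middle_change s] | s.1.1]| +
   #|[set s in [set s in slots | middle_change s] | ~~ s.1.1]| =
   #|[set s in slots | middle_change s]|)%N.
  rewrite -[RHS](cardsID [set s : (bool * T) * (T * T) | s.1.1]); congr (_ + _)%N.
    by apply: eq_card => s; rewrite !inE.
  by apply: eq_card => s; rewrite !inE andbC.
apply: leq_trans slot_changes _.
by rewrite -[4%N]/(2 * 2)%N -mulnA leq_mul2l card_slots orbT.
Qed.

(** A cyclic sequence has an even number of changes.  So if the linear order
    shows exactly three, the first and the last edge differ in colour, and they
    bound the downward corner. *)
Lemma corner_lower_bound v : (2 < changes (col v) (neighbours v))%N ->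
  (3 + (v \in two_sided) <= #|corner_changes v| + (v \in bottom_change))%N.
Proof.
move=> ch; have leq_ch := changes_leq_corner v.
have [two|_] := boolP (v \in two_sided); last first.
  by rewrite addn0; apply: leq_trans (leq_trans ch leq_ch) (leq_addr _ _).
have [_|nbot] := boolP (v \in bottom_change).
  by rewrite leq_add2r; apply: leq_trans ch leq_ch.
rewrite addn0 addn1; apply: leq_trans leq_ch.
rewrite ltn_neqAle ch andbT; apply/eqP => three.
have srt := sorted_neighbours v; have memE := mem_neighbours v.
case: (neighbours v) srt memE three => [|a s] srt memE three; first by [].
have := odd_changes (col v) a s; rewrite -three /= => /esym cal.
move: two; rewrite inE => /andP[/existsP[l /andP[vl lv]] /existsP[r /andP[vr rv]]].
have va : (v, a) \in E by rewrite -memE inE eqxx.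
have vb : (v, last a s) \in E by rewrite -memE mem_last.
have va_lt : x v < x a.
  rewrite -(angle_key_lt0 y) ?neighbour_x //.
  apply: le_lt_trans (sorted_head_min srt (_ : r \in _)) _; first by rewrite memE.
  by rewrite angle_key_lt0 ?neighbour_x.
have vb_lt : x (last a s) < x v.
  rewrite -(angle_key_gt0 y) ?neighbour_x //.
  apply: lt_le_trans (sorted_last_max srt (_ : l \in _)); last by rewrite memE.
  by rewrite angle_key_gt0 ?neighbour_x.
case/negP: nbot; rewrite inE; apply/existsP; exists (last a s, a).
rewrite /slot va vb va_lt vb_lt /middle_change /= eq_sym cal andbT.
apply/forallP => d; apply/implyP => vd; rewrite !mulN1r !lerN2.
have ds : d \in a :: s by rewrite memE.
apply/andP; split; apply/implyP => dv; rewrite leNgt -key_same_side //.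
- by rewrite -leNgt; apply: sorted_last_max srt _ _.
- by rewrite !ltNge !ltW.
- by rewrite -leNgt; apply: sorted_head_min srt _ _.
- by rewrite va_lt dv.
Qed.

(** Otherwise a vertex with neighbours on both sides would contribute at least 4
    to the count, and any other vertex at least 3, while the slots allow only 4
    for each vertex of the first kind.  A leftmost vertex is of the second
    kind. *)
Lemma few_changes (v0 : T) :
  exists v, (changes (col v) (neighbours v) <= 2)%N.
Proof.
apply: contrapT => /forallNP many.
have {}many v : (2 < changes (col v) (neighbours v))%N.
  by rewrite ltnNge; apply/negP/many.
have low : (\sum_v (3 + (v \in two_sided)) <= 4 * #|two_sided|)%N.
  apply: leq_trans corner_upper_bound; apply: leq_sum => v _.
  exact: corner_lower_bound.
have: (#|two_sided| < #|T|)%N.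
  rewrite -cardsT; apply: proper_card; rewrite properE finset.subsetT /=.
  have [m _ mmin] := Order.TotalTheory.arg_minP x (erefl : xpredT v0).
  apply/fintype.subsetPn; exists m => //; rewrite inE negb_and; apply/orP; left.
  by apply/existsPn => l; rewrite negb_and -leNgt mmin ?orbT.
move: low; rewrite big_split /= sum_nat_const.
rewrite [X in (_ + X)%N](_ : _ = #|two_sided|); last first.
  by rewrite -sum1_card [RHS]big_mkcond /=; apply: eq_bigr => v _; case: (v \in _).
rewrite mulSn addnC leq_add2l mulnC leq_mul2l /= => le lt.
by have := leq_ltn_trans le lt; rewrite ltnn.
Qed.

End Counting.

(** * Contact graphs of disk packings carry no stress *)

(** Edges of the maximal graph outside the support of the stress are coloured as
    if positive, which is compatible with [moment_changes]. *)
Lemma unloaded_vertex (R : rcfType) (T : finType) (x y : T -> R) (w : T -> T -> R) (v0 : T) :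
  injective x -> (forall i j, w i j = w j i) ->
  plane_graph x y [set e | w e.1 e.2 != 0] ->
  (forall i, \sum_j w i j * dist x y i j = 0) ->
  (forall i, \sum_j w i j * (x j - x i) = 0) ->
  (forall i, \sum_j w i j * (y j - y i) = 0) ->
  exists i, forall j, w i j = 0.
Proof.
move=> xinj wC pl hd hx hy.
have [E mxE /fintype.subsetP sub] := maximal_plane_graph_exists pl.
have colC i j : (0 <= w i j) = (0 <= w j i) by rewrite wC.
have [v few] := few_changes xinj mxE (col := fun i j => 0 <= w i j) colC v0.
exists v => j; apply/eqP; apply/negPn/negP => wj.
have mE i : w v i != 0 -> i \in neighbours x y E v.
  by move=> wi; rewrite mem_neighbours; apply: sub; rewrite inE.
have uq : uniq (neighbours x y E v) by rewrite sort_uniq enum_uniq.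
have srt := sorted_neighbours xinj mxE v.
have := @equilibrium_changes R T x y (w v) v (fun i => 0 <= w v i) _ uq srt.
rewrite ltnNge few /= => many; suff: false by []; apply: many => //.
- by move=> i; rewrite mem_neighbours; apply: (neighbour_x xinj mxE).
- by move=> i _; case: leP => // /ltW.
- by exists j.
Qed.

(** The counting needs a stress that loads every vertex, so it is applied to the
    graph induced on the loaded vertices. *)
Lemma plane_stress_free (R : rcfType) (T : finType) (x y : T -> R) (w : T -> T -> R) :
  injective x -> (forall i j, w i j = w j i) ->
  plane_graph x y [set e | w e.1 e.2 != 0] ->
  (forall i, \sum_j w i j * dist x y i j = 0) ->
  (forall i, \sum_j w i j * (x j - x i) = 0) ->
  (forall i, \sum_j w i j * (y j - y i) = 0) ->
  forall i j, w i j = 0.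
Proof.
move=> xinj wC pl hd hx hy i0 j0; apply/eqP/negPn/negP => w0.
pose A := [pred i | [exists j, w i j != 0]].
have memA i j : w i j != 0 -> j \in A.
  by move=> wij; rewrite inE; apply/existsP; exists i; rewrite wC.
have restrict (f : T -> T -> R) i : \sum_j w i j * f i j = 0 ->
    \sum_(j : {j in A}) w i (val j) * f i (val j) = 0.
  move=> s0; rewrite -(big_sub A (fun j => w i j * f i j)); rewrite -[RHS]s0.
  rewrite [RHS](bigID [in A]) /= [X in _ + X]big1 ?addr0 // => j jA.
  have [->|/memA] := eqVneq (w i j) 0; first exact: mul0r.
  by rewrite (negbTE jA).
have i0A : i0 \in A by apply: (memA j0); rewrite wC.
have [Esym Eirr Eth Emt] := pl.
have memE i j : (i, j) \in [set e | w e.1 e.2 != 0] = (w i j != 0) by rewrite inE.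
have [||||||i wi] := @unloaded_vertex R {i in A} (x \o val) (y \o val)
  (fun i j => w (val i) (val j)) (exist _ i0 i0A).
- by move=> i j /= /xinj /val_inj.
- by move=> i j; apply: wC.
- split.
  + by move=> i j; rewrite !inE /= wC.
  + move=> i j; rewrite !inE /= => wij.
    by apply/eqP => ij; have := Eirr (val i) (val j); rewrite memE wij ij eqxx => /(_ isT).
  + move=> i j k; rewrite !inE /= => wij th.
    by apply: (Eth (val i) (val j) (val k)); rewrite ?memE.
  + move=> i j k l; rewrite !inE /= => wij wkl mt.
    case: (Emt (val i) (val j) (val k) (val l)); rewrite ?memE //.
      by move=> [/val_inj -> /val_inj ->]; left.
    by move=> [/val_inj -> /val_inj ->]; right.
- by move=> i; exact: (restrict (dist x y) (val i) (hd _)).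
- by move=> i; exact: (restrict (fun i j => x j - x i) (val i) (hx _)).
- by move=> i; exact: (restrict (fun i j => y j - y i) (val i) (hy _)).
have /existsP[j wij] := valP i.
by have := wi (exist _ j (memA _ _ wij)); apply/eqP.
Qed.

Section Disks.
Variables (R : realFieldType) (T : finType) (x y r : T -> R).
Hypothesis r_gt0 : forall i, 0 < r i.
Hypothesis apart : forall i j, i != j ->
  (r i + r j) ^+ 2 <= (x i - x j) ^+ 2 + (y i - y j) ^+ 2.

Definition touch i j := i != j /\
  (x i - x j) ^+ 2 + (y i - y j) ^+ 2 = (r i + r j) ^+ 2.

Lemma touchC i j : touch i j -> touch j i.
Proof.
move=> [ij e]; rewrite /touch eq_sym -(opprB (x i)) -(opprB (y i)) !sqrrN.
by rewrite (addrC (r j)).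
Qed.

Local Notation dd i j := ((x i - x j) ^+ 2 + (y i - y j) ^+ 2).

(** If X is i or j with probabilities 1 - s and s, and Y is k or l with
    probabilities 1 - t and t, independently, then E|X - Y|^2 is the sum of the
    variances as soon as X and Y have the same mean.  This replaces the triangle
    inequality in the study of crossing contacts: the left side is large because
    the disks are apart, and the right side is small because i touches j and k
    touches l. *)
Lemma mean_distance i j k l s t :
  x i + s * (x j - x i) = x k + t * (x l - x k) ->
  y i + s * (y j - y i) = y k + t * (y l - y k) ->
  (1 - s) * (1 - t) * dd i k + (1 - s) * t * dd i l +
  s * (1 - t) * dd j k + s * t * dd j l =
  s * (1 - s) * dd i j + t * (1 - t) * dd k l.
Proof.
move=> hx hy.
have -> : s * (1 - s) * dd i j + t * (1 - t) * dd k l =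
  s * (1 - s) * dd i j + t * (1 - t) * dd k l +
  (x i + s * (x j - x i) - (x k + t * (x l - x k))) ^+ 2 +
  (y i + s * (y j - y i) - (y k + t * (y l - y k))) ^+ 2.
  by rewrite hx hy !subrr expr0n /= !addr0.
ring.
Qed.

Lemma touch_through i j k : touch i j -> ~ through x y i j k.
Proof.
move=> [ij eij] [s [s0 s1 hx hy]].
have eqk a : a = i \/ a = j -> k <> a.
  move=> aij ka; have : 0 < (r i + r j) ^+ 2 by rewrite exprn_gt0 // addr_gt0.
  rewrite -eij.
  case: aij => ea; rewrite ka ea in hx hy.
    have hx' : s * (x j - x i) = 0 by move: hx; lra.
    have hy' : s * (y j - y i) = 0 by move: hy; lra.
    move/eqP: hx'; move/eqP: hy'; rewrite !mulf_eq0 gt_eqF //= !subr_eq0.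
    by move=> /eqP -> /eqP ->; rewrite !subrr expr0n addr0 ltxx.
  have hx' : (1 - s) * (x j - x i) = 0 by move: hx; lra.
  have hy' : (1 - s) * (y j - y i) = 0 by move: hy; lra.
  have s1' : 1 - s != 0 by rewrite subr_eq0 gt_eqF.
  move/eqP: hx'; move/eqP: hy'; rewrite !mulf_eq0 (negbTE s1') //= !subr_eq0.
  by move=> /eqP -> /eqP ->; rewrite !subrr expr0n addr0 ltxx.
have ik : i != k by apply/eqP => ik; apply: (eqk i); [left|].
have jk : j != k by apply/eqP => jk; apply: (eqk j); [right|].
have := @mean_distance i j k k s 0; rewrite !mul0r !addr0 -hx -hy => /(_ erefl erefl).
rewrite subr0 !mulr0 !mul0r !addr0 !mulr1 eij => E.
have hi := apart ik; have hj := apart jk.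
have h : (1 - s) * (r i + r k) ^+ 2 + s * (r j + r k) ^+ 2 <= s * (1 - s) * (r i + r j) ^+ 2.
  rewrite -E lerD // ler_wpM2l //; lra.
have : 0 < ((1 - s) * r i - s * r j) ^+ 2 + r k ^+ 2 + 2 * r k * ((1 - s) * r i + s * r j).
  apply: addr_gt0; first by rewrite ltr_wpDl ?sqr_ge0 // exprn_gt0.
  by rewrite mulr_gt0 ?mulr_gt0 // addr_gt0 // mulr_gt0 // subr_gt0.
by lra.
Qed.

Lemma touch_meet_disjoint i j k l : touch i j -> touch k l ->
  i != k -> i != l -> j != k -> j != l -> ~ crosses x y i j k l.
Proof.
move=> [_ eij] [_ ekl] ik il jk jl [s [t [/andP[s0 s1] /andP[t0 t1] hx hy]]].
have := mean_distance hx hy; rewrite eij ekl => E.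
have s1' : 0 < 1 - s by rewrite subr_gt0.
have t1' : 0 < 1 - t by rewrite subr_gt0.
have h : (1 - s) * (1 - t) * (r i + r k) ^+ 2 + (1 - s) * t * (r i + r l) ^+ 2 +
  s * (1 - t) * (r j + r k) ^+ 2 + s * t * (r j + r l) ^+ 2 <=
  s * (1 - s) * (r i + r j) ^+ 2 + t * (1 - t) * (r k + r l) ^+ 2.
  by rewrite -E !lerD // ler_wpM2l ?apart // mulr_ge0 // ltW.
have : 0 < ((1 - s) * r i - s * r j) ^+ 2 + ((1 - t) * r k - t * r l) ^+ 2 +
   2 * ((1 - s) * r i + s * r j) * ((1 - t) * r k + t * r l).
  apply: ltr_wpDl; first by rewrite addr_ge0 ?sqr_ge0.
  by rewrite !mulr_gt0 ?addr_gt0 ?mulr_gt0.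
by lra.
Qed.

Lemma touch_meet_shared i j l : touch i j -> touch i l -> j != l -> ~ crosses x y i j i l.
Proof.
move=> [ij eij] [il eil] jl [s [t [/andP[s0 s1] /andP[t0 t1] hx hy]]].
have := mean_distance hx hy; rewrite eij eil => E.
have s1' : 0 < 1 - s by rewrite subr_gt0.
have t1' : 0 < 1 - t by rewrite subr_gt0.
have h : (1 - s) * t * (r i + r l) ^+ 2 +
  s * (1 - t) * (r j + r i) ^+ 2 + s * t * (r j + r l) ^+ 2 <=
  s * (1 - s) * (r i + r j) ^+ 2 + t * (1 - t) * (r i + r l) ^+ 2.
  rewrite -E !subrr expr0n /= addr0 mulr0 add0r.
  have ji : j != i by rewrite eq_sym.
  by rewrite !lerD // ler_wpM2l ?apart // mulr_ge0 // ltW.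
have : 0 < ((1 - s) * r i - s * r j - (1 - t) * r i + t * r l) ^+ 2 +
   4 * (s * r j) * (t * r l).
  by apply: ltr_wpDl; rewrite ?sqr_ge0 // !mulr_gt0.
by lra.
Qed.

Lemma contact_plane_graph (E : {set T * T}) :
  (forall i j, (i, j) \in E -> (j, i) \in E) ->
  (forall i j, (i, j) \in E -> touch i j) -> plane_graph x y E.
Proof.
move=> Esym Et; split.
- exact: Esym.
- by move=> i j /Et [].
- by move=> i j k /Et /touch_through; apply.
move=> i j k l /Et tij /Et tkl mt.
have [ik|ik] := eqVneq i k.
  left; subst k; congr (_, _); apply/eqP/negPn/negP; rewrite eq_sym => jl.
  exact: (touch_meet_shared tij tkl jl mt).
have [il|il] := eqVneq i l.
  right; subst l; congr (_, _); apply/eqP/negPn/negP; rewrite eq_sym => jk.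
  exact: (touch_meet_shared tij (touchC tkl) jk (crosses_sym (crosses_flip (crosses_sym mt)))).
have [jk|jk] := eqVneq j k.
  by subst k; case: (touch_meet_shared (touchC tij) tkl il (crosses_flip mt)).
have [jl|jl] := eqVneq j l.
  subst l; case: (touch_meet_shared (touchC tij) (touchC tkl) ik).
  exact: crosses_flip (crosses_sym (crosses_flip (crosses_sym mt))).
by case: (touch_meet_disjoint tij tkl ik il jk jl mt).
Qed.

End Disks.

(** Each pair of distinct points excludes a single value of [s]. *)
Lemma generic_slope (R : realFieldType) (T : finType) (x y : T -> R) :
  (forall i j, i != j -> (x i != x j) || (y i != y j)) ->
  exists s : R, injective (fun i => x i + s * y i).
Proof.
move=> distinct.
pose P : {poly R} := \prod_(e : T * T | e.1 != e.2)
  ((x e.1 - x e.2)%:P + (y e.1 - y e.2) *: 'X).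
have P0 : P != 0.
  apply/prodf_neq0 => -[i j] /= ij; apply/eqP => e.
  have at_ t : (x i - x j) + (y i - y j) * t = 0.
    by rewrite -[RHS](horner0 t) -e hornerD hornerC hornerZ hornerX.
  have dx : x i = x j by apply/eqP; rewrite -subr_eq0 -(at_ 0) mulr0 addr0.
  have dy : y i = y j.
    by apply/eqP; rewrite -subr_eq0 -[X in _ == X](at_ 1) mulr1 dx subrr add0r.
  by have := distinct i j ij; rewrite dx dy !eqxx.
have [k Pk] : exists k : nat, ~~ root P k%:R.
  apply: contrapT => /forallNP all_root.
  have := @max_poly_roots R P [seq k%:R | k <- iota 0 (size P)] P0.
  rewrite size_map size_iota ltnn => h; suff: false by []; apply: h.
    by apply/allP => _ /mapP[k _ ->]; apply/negPn/negP; apply: all_root.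
  rewrite map_inj_uniq ?iota_uniq // => a b /eqP; rewrite eqr_nat => /eqP; exact.
exists k%:R => i j eij; apply/eqP/negPn/negP => ij; case/negP: Pk.
rewrite /root /P horner_prod (bigD1 (i, j)) //= mulf_eq0; apply/orP; left.
rewrite hornerD hornerC hornerZ hornerX; apply/eqP; lra.
Qed.

(** A rotation followed by a dilation makes the abscissas distinct and keeps all
    the hypotheses, provided that the radii are dilated too. *)
Theorem contact_stress_free (R : rcfType) (T : finType) (x y r : T -> R)
    (w : T -> T -> R) :
  (forall i, 0 < r i) ->
  (forall i j, i != j -> (r i + r j) ^+ 2 <= (x i - x j) ^+ 2 + (y i - y j) ^+ 2) ->
  (forall i j, w i j = w j i) ->
  (forall i j, w i j != 0 -> touch x y r i j) ->
  (forall i, \sum_j w i j * (r i + r j) = 0) ->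
  (forall i, \sum_j w i j * (x j - x i) = 0) ->
  (forall i, \sum_j w i j * (y j - y i) = 0) ->
  forall i j, w i j = 0.
Proof.
move=> r_gt0 apart wC wt hr hx hy.
have [s inj] : exists s : R, injective (fun i => x i + s * y i).
  apply: generic_slope => i j ij; apply: contraTT (apart i j ij).
  rewrite negb_or !negbK => /andP[/eqP -> /eqP ->]; rewrite !subrr expr0n addr0 -ltNge.
  by rewrite exprn_gt0 // addr_gt0.
pose k := Num.sqrt (1 + s ^+ 2).
have k2 : k ^+ 2 = 1 + s ^+ 2 by rewrite sqr_sqrtr // addr_ge0 // sqr_ge0.
have k0 : 0 < k by rewrite sqrtr_gt0 ltr_wpDr // sqr_ge0.
pose X i := x i + s * y i; pose Y i := y i - s * x i; pose r' i := k * r i.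
have ddE i j : (X i - X j) ^+ 2 + (Y i - Y j) ^+ 2 =
    k ^+ 2 * ((x i - x j) ^+ 2 + (y i - y j) ^+ 2).
  by rewrite k2 /X /Y; ring.
have rrE i j : (r' i + r' j) ^+ 2 = k ^+ 2 * (r i + r j) ^+ 2.
  by rewrite /r'; ring.
have wt' i j : w i j != 0 -> touch X Y r' i j.
  by move=> /wt[ij e]; split; rewrite // ddE rrE e.
apply: (@plane_stress_free R T X Y w inj wC).
- apply: (@contact_plane_graph R T X Y r').
  + by move=> i; rewrite mulr_gt0.
  + by move=> i j ij; rewrite ddE rrE ler_wpM2l ?sqr_ge0 // apart.
  + by move=> i j; rewrite !inE /= wC.
  + by move=> i j; rewrite inE; apply: wt'.
- move=> i; rewrite -[RHS](mulr0 k) -[in RHS](hr i) mulr_sumr; apply: eq_bigr => j _.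
  have [->|/wt'[_ e]] := eqVneq (w i j) 0; first by rewrite !mul0r mulr0.
  rewrite distC /dist e sqrtr_sqr ger0_norm; first by rewrite /r'; ring.
  by rewrite addr_ge0 // mulr_ge0 // ltW.
- move=> i; transitivity (\sum_j w i j * (x j - x i) + s * \sum_j w i j * (y j - y i)).
    by rewrite mulr_sumr -big_split; apply: eq_bigr => j _ /=; rewrite /X; ring.
  by rewrite hx hy mulr0 addr0.
- move=> i; transitivity (\sum_j w i j * (y j - y i) - s * \sum_j w i j * (x j - x i)).
    by rewrite mulr_sumr -sumrB; apply: eq_bigr => j _ /=; rewrite /Y; ring.
  by rewrite hx hy mulr0 subr0.
Qed.

(** * Extending derivations *)
Section Derivations.
Variable R : realFieldType.

Record derivation_on (K : R -> Prop) (D : R -> R) : Prop := DerivationOn {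
  dom1 : K 1;
  domB : forall a b, K a -> K b -> K (a - b);
  domM : forall a b, K a -> K b -> K (a * b);
  derB : forall a b, K a -> K b -> D (a - b) = D a - D b;
  derM : forall a b, K a -> K b -> D (a * b) = D a * b + a * D b }.

Section Extension.
Variables (K : R -> Prop) (D : R -> R).
Hypothesis KD : derivation_on K D.

Lemma dom0 : K 0.
Proof. by rewrite -(subrr 1); apply: (domB KD); apply: (dom1 KD). Qed.

Lemma domN a : K a -> K (- a).
Proof. by rewrite -sub0r; apply: (domB KD); apply: dom0. Qed.

Lemma domD a b : K a -> K b -> K (a + b).
Proof. by move=> Ka Kb; rewrite -[b]opprK; apply: (domB KD) => //; apply: domN. Qed.

Lemma der0 : D 0 = 0.
Proof. by have := derB KD (dom1 KD) (dom1 KD); rewrite !subrr. Qed.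

Lemma derN a : K a -> D (- a) = - D a.
Proof. by move=> Ka; rewrite -sub0r (derB KD dom0 Ka) der0 sub0r. Qed.

Lemma derD a b : K a -> K b -> D (a + b) = D a + D b.
Proof.
move=> Ka Kb; rewrite -[b in LHS]opprK (derB KD Ka (domN Kb)) derN // opprK //.
Qed.

Lemma dom_sum (I : Type) (s : seq I) (F : I -> R) :
  (forall i, K (F i)) -> K (\sum_(i <- s) F i).
Proof. by move=> KF; apply: big_ind => //; [apply: dom0|apply: domD]. Qed.

Lemma der_sum (I : Type) (s : seq I) (F : I -> R) :
  (forall i, K (F i)) -> D (\sum_(i <- s) F i) = \sum_(i <- s) D (F i).
Proof.
move=> KF; elim: s => [|i s IH]; first by rewrite !big_nil der0.
by rewrite !big_cons derD ?IH //; apply: dom_sum.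
Qed.

Definition poly_in (f : {poly R}) : Prop := forall i, K f`_i.

Lemma polyKC c : K c -> poly_in c%:P.
Proof. by move=> Kc i; rewrite coefC; case: eqP => // _; apply: dom0. Qed.

Lemma polyKX : poly_in 'X.
Proof. by move=> i; rewrite coefX; case: eqP => _; [apply: (dom1 KD)|apply: dom0]. Qed.

Lemma polyKB f g : poly_in f -> poly_in g -> poly_in (f - g).
Proof. by move=> Kf Kg i; rewrite coefB; apply: (domB KD). Qed.

Lemma polyKM f g : poly_in f -> poly_in g -> poly_in (f * g).
Proof. by move=> Kf Kg i; rewrite coefM; apply: dom_sum => j; apply: (domM KD). Qed.

Lemma polyKXn n : poly_in 'X^n.
Proof.
move=> i; rewrite coefXn; case: eqP => _; [exact: (dom1 KD)|exact: dom0].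
Qed.

Lemma polyK_deriv f : poly_in f -> poly_in f^`().
Proof.
move=> Kf i; rewrite coef_deriv; move: (f`_i.+1) (Kf i.+1) => c Kc.
elim: i.+1 => [|m IH]; first by rewrite mulr0n; apply: dom0.
by rewrite mulrS; apply: domD.
Qed.

Lemma coef_map_der f i : (map_poly D f)`_i = D f`_i.
Proof. by rewrite coef_map_id0 // der0. Qed.

Lemma map_derB f g : poly_in f -> poly_in g -> map_poly D (f - g) = map_poly D f - map_poly D g.
Proof.
by move=> Kf Kg; apply/polyP => i; rewrite coefB !coef_map_der coefB (derB KD).
Qed.

Lemma map_derM f g : poly_in f -> poly_in g ->
  map_poly D (f * g) = map_poly D f * g + f * map_poly D g.
Proof.
move=> Kf Kg; apply/polyP => i; rewrite coefD !coef_map_der !coefM der_sum; last first.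
  by move=> j; apply: (domM KD).
rewrite -big_split; apply: eq_bigr => j _ /=.
by rewrite (derM KD) // !coef_map_der.
Qed.

Variable a : R.

(** The value at f(a) of the derivation that extends [D] and maps [a] to [b]:
    apply [D] to the coefficients, then add f'(a) b. *)
Definition poly_der (b : R) (f : {poly R}) : R := (map_poly D f).[a] + f^`().[a] * b.

Lemma poly_derB b f g : poly_in f -> poly_in g -> poly_der b (f - g) = poly_der b f - poly_der b g.
Proof.
by move=> Kf Kg; rewrite /poly_der map_derB // derivB !hornerD !hornerN; ring.
Qed.

Lemma poly_derM b f g : poly_in f -> poly_in g ->
  poly_der b (f * g) = poly_der b f * g.[a] + f.[a] * poly_der b g.
Proof.
by move=> Kf Kg; rewrite /poly_der map_derM // derivM !hornerD !hornerM; ring.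
Qed.

Lemma poly_derC b c : K c -> poly_der b c%:P = D c.
Proof.
move=> Kc; rewrite /poly_der derivC horner0 mul0r addr0.
have -> : map_poly D c%:P = (D c)%:P.
  by apply/polyP => i; rewrite coef_map_der !coefC; case: eqP => // _; apply: der0.
by rewrite hornerC.
Qed.

(** The extension is well defined if polynomials vanishing at [a] are sent to 0.
    When [a] is transcendental over [K], any [b] will do.  Otherwise [b] is
    dictated by a polynomial f of least degree vanishing at [a], whose derivative
    does not vanish at [a] in characteristic 0; the other polynomials are reduced
    by pseudo-division by f. *)
Lemma poly_der_eq0 : exists b, forall f, poly_in f -> f.[a] = 0 -> poly_der b f = 0.
Proof.
pose rel (n : nat) := `[< exists f, [/\ poly_in f, f != 0, f.[a] = 0 & size f = n] >].
have [alg|transc] := pselect (exists n, rel n); last first.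
  exists 0 => f Kf fa; have -> : f = 0.
    by apply/eqP/negPn/negP => f0; apply: transc; exists (size f); apply/asboolP; exists f.
  by rewrite -[0 : {poly R}]/(0%:P) poly_derC ?der0 //; apply: dom0.
case: (ex_minnP alg) => n /asboolP[f [Kf f0 fa <-]] {alg} fmin.
have {}fmin g : poly_in g -> g.[a] = 0 -> (size g < size f)%N -> g = 0.
  move=> Kg ga lt; apply/eqP/negPn/negP => g0; move: lt; rewrite ltnNge fmin //.
  by apply/asboolP; exists g.
have szf : (1 < size f)%N.
  rewrite ltnNge; apply/negP => /size1_polyC e; move: fa f0; rewrite e hornerC => ->.
  by rewrite eqxx.
have f'a : f^`().[a] != 0.
  apply/eqP => f'a; have f'0 := fmin _ (polyK_deriv Kf) f'a (lt_size_deriv f0).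
  have := congr1 (fun q : {poly R} => q`_((size f).-2)) f'0.
  rewrite coef_deriv coef0 => /eqP; rewrite mulrn_eq0 /=.
  have -> : (size f).-2.+1 = (size f).-1 by case: (size f) szf => [|[]].
  by rewrite -[f`_ _]/(lead_coef f) lead_coef_eq0 (negbTE f0).
exists (- (map_poly D f).[a] / f^`().[a]).
set b := _ / _.
have fder : poly_der b f = 0 by rewrite /poly_der /b mulrC divfK // subrr.
move=> g; move: {2}(size g) (leqnn (size g)) => m.
elim: m g => [|m IH] g szg Kg ga.
  move: szg; rewrite leqn0 size_poly_eq0 => /eqP ->.
  by rewrite -[0 : {poly R}]/(0%:P) poly_derC ?der0 //; apply: dom0.
have [lt|le] := ltnP (size g) (size f).
  rewrite (fmin g) //.
  by rewrite -[0 : {poly R}]/(0%:P) poly_derC ?der0 //; apply: dom0.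
(* cancel the leading term of [g] with a multiple of [f] *)
pose c := lead_coef f.
have [d dE] : exists d, d = (size g - size f)%N by exists (size g - size f)%N.
pose q := (lead_coef g)%:P * 'X^d.
have Kc : poly_in c%:P by apply: polyKC; apply: Kf.
have Kq : poly_in q by apply: polyKM; [apply: polyKC; apply: Kg|apply: polyKXn].
have Kcg := polyKM Kc Kg; have Kqf := polyKM Kq Kf.
have szr : (size (c%:P * g - q * f)%R <= m)%N.
  rewrite -ltnS; apply: leq_trans szg; have g0 : g != 0.
    by rewrite -size_poly_eq0 -lt0n (leq_trans _ le) // (leq_trans _ szf).
  rewrite -[X in (_ < X)%N](@prednK (size g)) ?lt0n ?size_poly_eq0 // ltnS.
  apply/leq_sizeP => j hj; rewrite coefB coefCM /q -mulrA coefCM coefXnM.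
  have [jd|dj] := ltnP j d.
    by exfalso; move: hj szf le dE jd; clear; lia.
  have [e|ne] := eqVneq j (size g).-1.
    have -> : (j - d)%N = (size f).-1 by move: e szf le dE dj; clear; lia.
    by rewrite e /c /lead_coef mulrC subrr.
  have gj_le : (size g <= j)%N.
    by apply: leq_trans (leqSpred _) _; rewrite ltn_neqAle eq_sym ne.
  have gj : g`_j = 0 by apply: nth_default.
  have fj : f`_(j - d) = 0 by apply: nth_default; rewrite dE subnBA // addnC -addnBA // leq_addr.
  by rewrite gj fj !mulr0 subrr.
have r0 : poly_der b (c%:P * g - q * f) = 0.
  apply: IH => //; first exact: polyKB.
  by rewrite hornerD hornerN !hornerM ga fa !mulr0 subrr.
move: r0; rewrite poly_derB // (poly_derM b Kc Kg) (poly_derM b Kq Kf) ga fa fder.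
rewrite !mulr0 hornerC addr0 subr0 add0r.
by move/eqP; rewrite mulf_eq0 lead_coef_eq0 (negbTE f0) => /eqP.
Qed.

Lemma derivation_extend : exists K' D', [/\ derivation_on K' D', K' a &
  forall c, K c -> K' c /\ D' c = D c].
Proof.
have [b hb] := poly_der_eq0.
pose K' z := exists f, poly_in f /\ f.[a] = z.
pose D' z := if pselect (K' z) is left h then poly_der b (projT1 (cid h)) else 0.
have D'E f : poly_in f -> D' f.[a] = poly_der b f.
  move=> Kf; rewrite /D'; case: pselect => [h|[]]; last by exists f.
  case: (cid h) => g [Kg ga] /=; apply/eqP; rewrite -subr_eq0 -poly_derB //.
  by apply/eqP/hb; [apply: polyKB|rewrite hornerD hornerN ga subrr].
exists K', D'; split.
- split.
  + by exists 1%:P; split; [apply/polyKC/(dom1 KD)|rewrite hornerC].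
  + move=> _ _ [f [Kf <-]] [g [Kg <-]]; exists (f - g).
    by split; [apply: polyKB|rewrite hornerD hornerN].
  + move=> _ _ [f [Kf <-]] [g [Kg <-]]; exists (f * g).
    by split; [apply: polyKM|rewrite hornerM].
  + move=> _ _ [f [Kf <-]] [g [Kg <-]]; rewrite -hornerN -hornerD !D'E //.
      exact: poly_derB.
    exact: polyKB.
  + move=> _ _ [f [Kf <-]] [g [Kg <-]]; rewrite -hornerM !D'E //.
      exact: poly_derM.
    exact: polyKM.
- by exists 'X; split; [apply: polyKX|rewrite hornerX].
- move=> c Kc; split; first by exists c%:P; split; [apply: polyKC|rewrite hornerC].
  by rewrite -[c in LHS](hornerC c a) D'E ?poly_derC //; apply: polyKC.
Qed.

End Extension.

Lemma derivation_extend_seq (K : R -> Prop) (D : R -> R) (s : seq R) :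
  derivation_on K D -> exists K' D', [/\ derivation_on K' D',
    (forall a, a \in s -> K' a) & forall c, K c -> K' c /\ D' c = D c].
Proof.
elim: s K D => [|a s IH] K D KD; first by exists K, D; split.
have [K1 [D1 [KD1 K1a ext1]]] := derivation_extend KD a.
have [K2 [D2 [KD2 K2s ext2]]] := IH K1 D1 KD1.
exists K2, D2; split => //.
- by move=> b; rewrite inE => /predU1P[->|/K2s //]; have [] := ext2 _ K1a.
- move=> c Kc; have [K1c <-] := ext1 c Kc; exact: ext2.
Qed.

End Derivations.

(** * Derivations from algebraic independence *)

(** On the polynomial expressions in [v], the combination of partial derivatives
    with coefficients [c] is well defined because [v] satisfies no polynomial
    relation. *)
Lemma generic_derivation (R : realType) (N : nat) (v : 'I_N -> R) (c : 'I_N -> R) (s : seq R) :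
  generic v -> exists K D, [/\ derivation_on K D, forall k, K (v k) /\ D (v k) = c k &
    forall a, a \in s -> K a].
Proof.
move=> gen.
pose ev (P : mpoly.mpoly N rat) : R := mpoly.mmap ratr v P.
pose dv (P : mpoly.mpoly N rat) : R := \sum_k c k * ev (mpoly.mderiv k P).
pose K z := exists P, ev P = z.
pose D z := if pselect (K z) is left h then dv (projT1 (cid h)) else 0.
have evB P Q : ev (P - Q) = ev P - ev Q by rewrite /ev mpoly.mmapB.
have evD P Q : ev (P + Q) = ev P + ev Q by rewrite /ev mpoly.mmapD.
have evM P Q : ev (P * Q) = ev P * ev Q.
  exact: (rmorphM (mpoly.mmap ratr v)).
have dvB P Q : dv (P - Q) = dv P - dv Q.
  rewrite /dv -sumrB; apply: eq_bigr => k _.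
  by rewrite mpoly.mderivB evB mulrBr.
have dvM P Q : dv (P * Q) = dv P * ev Q + ev P * dv Q.
  rewrite /dv mulr_suml mulr_sumr -big_split; apply: eq_bigr => k _ /=.
  rewrite mpoly.mderivM evD !evM; ring.
have DE P : D (ev P) = dv P.
  rewrite /D; case: pselect => [h|[]]; last by exists P.
  case: (cid h) => Q eQ /=; suff -> : Q = P by [].
  by apply/eqP; rewrite -subr_eq0; apply/eqP/gen; rewrite -/(ev _) evB eQ subrr.
have KD : derivation_on K D.
  split.
  - exists 1; exact: (rmorph1 (mpoly.mmap ratr v)).
  - by move=> _ _ [P <-] [Q <-]; exists (P - Q).
  - by move=> _ _ [P <-] [Q <-]; exists (P * Q).
  - by move=> _ _ [P <-] [Q <-]; rewrite -evB !DE.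
  - by move=> _ _ [P <-] [Q <-]; rewrite -evM !DE.
have [K' [D' [KD' Ks ext]]] := derivation_extend_seq s KD.
exists K', D'; split=> // k.
have evX : ev (mpoly.mpolyX rat (mpoly.mnm1 k)) = v k.
  by rewrite /ev mpoly.mmapX mpoly.mmap1U.
have Kv : K (v k) by exists (mpoly.mpolyX rat (mpoly.mnm1 k)).
have [K'v ->] := ext _ Kv; split=> //.
rewrite -evX DE /dv (bigD1 k) //= big1 ?addr0.
  rewrite mpoly.mderivX mpoly.mnm1E eqxx scale1r.
  rewrite -[X in mpoly.mnm_sub X _](mpoly.add0m (mpoly.mnm1 k)) mpoly.addmK mpoly.mpolyX0.
  by rewrite [ev _](rmorph1 (mpoly.mmap ratr v)) mulr1.
move=> l lk; rewrite mpoly.mderivX mpoly.mnm1E eq_sym (negbTE lk) scale0r.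
by rewrite /ev mpoly.mmap0 mulr0.
Qed.

(** * Disks with disjoint interiors *)
Section DiskDistance.
Local Open Scope classical_set_scope.
Variable R : realType.

Lemma dotE (u v : 'rV[R]_2) : dot u v = u 0 0 * v 0 0 + u 0 1 * v 0 1.
Proof.
rewrite /dot !big_ord_recr big_ord0 /= add0r.
by congr (_ * _ + _ * _); congr (_ 0 _); apply: val_inj.
Qed.

Lemma disk_interior (c z : 'rV[R]_2) (rho : R) : 0 < rho ->
  dot (z - c) (z - c) < rho ^+ 2 -> (disk c rho)° z.
Proof.
move=> rho0 lt.
have cc k : {for z, continuous (fun x : 'rV[R]_2 => (x - c) 0 k)}.
  have -> : (fun x : 'rV[R]_2 => (x - c) 0 k) = (fun x => x 0 k) - cst (c 0 k).
    by apply/funext => x; rewrite !fctE /= !mxE.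
  by apply: continuousB; [exact: coord_continuous|exact: cst_continuous].
have cont : {for z, continuous (fun x : 'rV[R]_2 => dot (x - c) (x - c))}.
  have -> : (fun x : 'rV[R]_2 => dot (x - c) (x - c)) =
      (fun x => (x - c) 0 0) * (fun x => (x - c) 0 0) +
      (fun x => (x - c) 0 1) * (fun x => (x - c) 0 1).
    by apply/funext => x; rewrite dotE !fctE.
  by apply: continuousD; apply: continuousM; apply: cc.
have nb : \forall x \near z, dot (x - c) (x - c) < rho ^+ 2 by apply: (cvgr_lt _ cont).
rewrite /interior /=; apply: filterS nb => x lt'.
rewrite /disk /= /enorm -(ger0_norm (ltW rho0)) -sqrtr_sqr ler_sqrt ?sqr_ge0 //.
exact: ltW.
Qed.

(** If the disks were closer, the point that divides the segment between the
    centers in the ratio of the radii would be interior to both. *)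
Lemma disk_packing_apart (n : nat) (p : 'I_n -> 'rV[R]_2) (r : 'I_n -> R) :
  disk_packing p r -> forall i j, i != j ->
  (r i + r j) ^+ 2 <= dot (p i - p j) (p i - p j).
Proof.
move=> [r0 disj] i j ij; rewrite leNgt; apply/negP => lt.
have rij : 0 < r i + r j by rewrite addr_gt0.
pose s := r i / (r i + r j).
pose z := p i + s *: (p j - p i).
have scale (u : 'rV[R]_2) (a : R) : dot (a *: u) (a *: u) = a ^+ 2 * dot u u.
  by rewrite !dotE !mxE; ring.
have sq (a : R) : 0 < a -> (a / (r i + r j)) ^+ 2 * dot (p i - p j) (p i - p j) < a ^+ 2.
  move=> a0; have -> : a ^+ 2 = (a / (r i + r j)) ^+ 2 * (r i + r j) ^+ 2.
    by rewrite -exprMn divfK // gt_eqF.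
  by rewrite ltr_pM2l // exprn_gt0 // divr_gt0.
have : ((disk (p i) (r i))° `&` (disk (p j) (r j))°) z.
  split; apply: disk_interior => //.
    have -> : z - p i = (- s) *: (p i - p j).
      by apply/matrixP => a b; rewrite !mxE; ring.
    by rewrite scale sqrrN sq.
  have -> : z - p j = (r j / (r i + r j)) *: (p i - p j).
    apply/matrixP => a b; rewrite !mxE /s; field; exact: lt0r_neq0.
  by rewrite scale sq.
by rewrite disj.
Qed.

Lemma tangent_touch (n : nat) (p : 'I_n -> 'rV[R]_2) (r : 'I_n -> R) i j :
  (forall i, 0 < r i) -> tangent p r i j ->
  touch (fun i => p i 0 0) (fun i => p i 0 1) r i j.
Proof.
move=> r0 /andP[ij /eqP e]; split=> //; rewrite -e /enorm sqr_sqrtr dotE !mxE.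
  by rewrite !expr2.
by rewrite -!expr2 addr_ge0 ?sqr_ge0.
Qed.

End DiskDistance.

(** * The linearized contact conditions *)
Section ContactMatrix.
Variables (R : realFieldType) (n : nat) (x y r : 'I_n -> R) (C : {set 'I_n * 'I_n}).

Definition gap_rows (z : 'I_n -> R) : 'M[R]_(n, #|C|) :=
  \matrix_(i, e) (((i == (enum_val e).2)%:R - (i == (enum_val e).1)%:R) *
                  (z (enum_val e).2 - z (enum_val e).1)).

Definition flex_matrix : 'M[R]_(n + n, #|C|) := col_mx (gap_rows x) (gap_rows y).

Definition radius_rows : 'M[R]_(n, #|C|) :=
  \matrix_(i, e) - (((i == (enum_val e).2)%:R + (i == (enum_val e).1)%:R) *
                    (r (enum_val e).1 + r (enum_val e).2)).

(** Columns are indexed by contacts: multiplying a row vector of velocities by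
    this matrix gives half the derivatives of |p_i - p_j|^2 - (r_i + r_j)^2. *)
Definition contact_matrix : 'M[R]_(n + n + n, #|C|) := col_mx flex_matrix radius_rows.

Definition pack2 (a b : 'I_n -> R) : 'rV[R]_(n + n) :=
  row_mx (\row_i a i) (\row_i b i).

Definition pack3 (a b c : 'I_n -> R) : 'rV[R]_(n + n + n) :=
  row_mx (pack2 a b) (\row_i c i).

Lemma pack2K (v : 'rV[R]_(n + n)) :
  v = pack2 (fun i => lsubmx v 0 i) (fun i => rsubmx v 0 i).
Proof.
rewrite -[LHS]hsubmxK /pack2; congr row_mx; apply/rowP => i; by rewrite [RHS]mxE.
Qed.

Lemma sum_delta (a : 'I_n -> R) k : \sum_i a i * (i == k)%:R = a k.
Proof.
rewrite (bigD1 k) //= eqxx mulr1 big1 ?addr0 // => i /negbTE ->.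
by rewrite mulr0.
Qed.

Lemma mul_gap_rows (a z : 'I_n -> R) e :
  ((\row_i a i) *m gap_rows z) 0 e =
  (a (enum_val e).2 - a (enum_val e).1) * (z (enum_val e).2 - z (enum_val e).1).
Proof.
rewrite mxE; under eq_bigr => i _ do rewrite !mxE mulrA [a i * _]mulrBr.
by rewrite -mulr_suml sumrB !sum_delta.
Qed.

Lemma mul_flex_matrix a b e : (pack2 a b *m flex_matrix) 0 e =
  (a (enum_val e).2 - a (enum_val e).1) * (x (enum_val e).2 - x (enum_val e).1) +
  (b (enum_val e).2 - b (enum_val e).1) * (y (enum_val e).2 - y (enum_val e).1).
Proof. by rewrite mul_row_col mxE !mul_gap_rows. Qed.

Lemma mul_contact_matrix a b c e : (pack3 a b c *m contact_matrix) 0 e =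
  (a (enum_val e).2 - a (enum_val e).1) * (x (enum_val e).2 - x (enum_val e).1) +
  (b (enum_val e).2 - b (enum_val e).1) * (y (enum_val e).2 - y (enum_val e).1) -
  (c (enum_val e).1 + c (enum_val e).2) * (r (enum_val e).1 + r (enum_val e).2).
Proof.
rewrite mul_row_col mxE mul_flex_matrix; congr (_ + _).
rewrite mxE; under eq_bigr => i _ do rewrite !mxE mulrN mulrA [c i * _]mulrDr.
by rewrite sumrN -mulr_suml big_split /= !sum_delta addrC [X in - (X * _)]addrC.
Qed.

(** The rows are the two translations and the rotation about the origin. *)
Definition isometry_matrix : 'M[R]_(1 + (1 + 1), n + n) :=
  col_mx (pack2 (fun=> 1) (fun=> 0))
    (col_mx (pack2 (fun=> 0) (fun=> 1)) (pack2 (fun i => - y i) x)).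

Lemma isometry_flex : isometry_matrix *m flex_matrix = 0.
Proof.
rewrite !mul_col_mx -[RHS]col_mx0; congr col_mx; last (rewrite -[RHS]col_mx0; congr col_mx);
  apply/rowP => e; rewrite mul_flex_matrix mxE; ring.
Qed.

Lemma mul_isometry (a b c : R) :
  row_mx a%:M (row_mx b%:M c%:M) *m isometry_matrix =
  pack2 (fun i => a - c * y i) (fun i => b + c * x i).
Proof.
rewrite !mul_row_col !mul_scalar_mx /pack2 !scale_row_mx !add_row_mx.
by congr row_mx; apply/rowP => i; rewrite !mxE; ring.
Qed.

Lemma isometry_free i j : x i != x j \/ y i != y j -> row_free isometry_matrix.
Proof.
move=> ij; apply: inj_row_free => v.
rewrite -[v]hsubmxK -[rsubmx v]hsubmxK [lsubmx v]mx11_scalar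
  [lsubmx (rsubmx v)]mx11_scalar [rsubmx (rsubmx v)]mx11_scalar.
move: (lsubmx v 0 0) (lsubmx (rsubmx v) 0 0) (rsubmx (rsubmx v) 0 0) => a b c.
rewrite mul_isometry => /eqP; rewrite row_mx_eq0 => /andP[/eqP h1 /eqP h2].
have hx k : a - c * y k = 0 by have := congr1 (fun M : 'rV_n => M 0 k) h1; rewrite !mxE.
have hy k : b + c * x k = 0 by have := congr1 (fun M : 'rV_n => M 0 k) h2; rewrite !mxE.
have c0 : c = 0.
  case: ij => ij; [have h : c * (x i - x j) = 0|have h : c * (y i - y j) = 0].
  - by have := hy i; have := hy j; lra.
  - by move/eqP: h; rewrite mulf_eq0 subr_eq0 (negbTE ij) orbF => /eqP.
  - by have := hx i; have := hx j; lra.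
  - by move/eqP: h; rewrite mulf_eq0 subr_eq0 (negbTE ij) orbF => /eqP.
have := hx i; have := hy i; rewrite c0 !mul0r subr0 addr0 => -> ->.
by rewrite !raddf0 !row_mx0.
Qed.

(** The symmetric form of a stress given on contacts, each listed once. *)
Definition edge_weight (v : 'rV[R]_#|C|) (i j : 'I_n) : R :=
  \sum_e v 0 e * ((enum_val e == (i, j))%:R + (enum_val e == (j, i))%:R).

Lemma edge_weightC v i j : edge_weight v i j = edge_weight v j i.
Proof. by apply: eq_bigr => e _; rewrite addrC. Qed.

Lemma edge_weight_neq0 v i j : edge_weight v i j != 0 -> (i, j) \in C \/ (j, i) \in C.
Proof.
move=> w0; apply: contrapT => /not_orP[h1 h2]; case/eqP: w0.
apply: big1 => e _; have eC := enum_valP e.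
have [e1|_] := eqVneq (enum_val e) (i, j); first by rewrite e1 in eC.
have [e2|_] := eqVneq (enum_val e) (j, i); first by rewrite e2 in eC.
by rewrite addr0 mulr0.
Qed.

Lemma edge_weight_sum v i (f : 'I_n -> R) :
  \sum_j edge_weight v i j * f j =
  \sum_e v 0 e * ((i == (enum_val e).2)%:R * f (enum_val e).1 +
                  (i == (enum_val e).1)%:R * f (enum_val e).2).
Proof.
under eq_bigr => j _ do rewrite mulr_suml.
rewrite exchange_big /=; apply: eq_bigr => e _.
under eq_bigr => j _ do rewrite -mulrA.
rewrite -mulr_sumr; congr (_ * _); case: (enum_val e) => k l /=.
have h (c d : 'I_n) : \sum_j (c == i)%:R * (d == j)%:R * f j = (i == c)%:R * f d.
  under eq_bigr => j _ do rewrite -mulrA (eq_sym d) [(j == d)%:R * _]mulrC.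
  by rewrite -mulr_sumr sum_delta eq_sym.
under eq_bigr => j _ do rewrite !xpair_eqE mulrDl.
rewrite big_split /= addrC -!h; congr (_ + _); apply: eq_bigr => j _.
  by rewrite andbC -mulnb natrM.
by rewrite -mulnb natrM.
Qed.

Lemma edge_weight_eq0 v : (forall e, e \in C -> (e.1 < e.2)%N) ->
  (forall i j, edge_weight v i j = 0) -> v = 0.
Proof.
move=> lt w0; apply/rowP => e; rewrite mxE -(w0 (enum_val e).1 (enum_val e).2).
rewrite /edge_weight (bigD1 e) //= big1 ?addr0.
  have -> : (enum_val e == ((enum_val e).2, (enum_val e).1)) = false.
    apply/negP => /eqP h; have := lt _ (enum_valP e).
    by rewrite {1}h /= ltnn.
  by rewrite -surjective_pairing eqxx addr0 mulr1.
move=> e' ne; rewrite -surjective_pairing (inj_eq enum_val_inj) (negbTE ne) add0r.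
have [h|_] := eqVneq (enum_val e') _; last by rewrite mulr0.
by have := lt _ (enum_valP e'); rewrite h /= ltnNge ltnW // lt // enum_valP.
Qed.

End ContactMatrix.

Lemma contact_matrix_rank (R : rcfType) (n : nat) (x y r : 'I_n -> R)
    (C : {set 'I_n * 'I_n}) :
  (forall i, 0 < r i) ->
  (forall i j, i != j -> (r i + r j) ^+ 2 <= (x i - x j) ^+ 2 + (y i - y j) ^+ 2) ->
  (forall e, e \in C -> (e.1 < e.2)%N) ->
  (forall e, e \in C -> touch x y r e.1 e.2) ->
  \rank (contact_matrix x y r C) = #|C|.
Proof.
move=> r0 apart lt tC; rewrite -mxrank_tr; apply/eqP; rewrite -/(row_free _).
apply: inj_row_free => v; rewrite -[v]trmxK -trmx_mul => /(congr1 trmx).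
rewrite !trmxK trmx0 => h.
have {h} hrow k : \sum_e contact_matrix x y r C k e * v 0 e = 0.
  have := congr1 (fun M : 'cV_(n + n + n) => M k 0) h; rewrite !mxE => e0.
  by rewrite -[RHS]e0; apply: eq_bigr => e _; rewrite [v^T _ _]mxE.
have hgap z : (forall i, \sum_e gap_rows C z i e * v 0 e = 0) ->
    forall i, \sum_j edge_weight v i j * (z j - z i) = 0.
  move=> hz i; rewrite (edge_weight_sum v i (fun j => z j - z i)).
  rewrite -[RHS]oppr0 -[in RHS](hz i) -sumrN; apply: eq_bigr => e _; rewrite mxE.
  case: (enum_val e) => k l /=.
  have [->|_] := eqVneq i l.
    by have [->|_] := eqVneq l k; rewrite /=; ring.
  by have [->|_] := eqVneq i k; rewrite /=; ring.
apply: (edge_weight_eq0 lt); apply: (contact_stress_free r0 apart).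
- exact: edge_weightC.
- by move=> i j /edge_weight_neq0[/tC|/tC/touchC].
- move=> i; rewrite (edge_weight_sum v i (fun j => r i + r j)).
  rewrite -[RHS]oppr0 -[in RHS](hrow (rshift _ i)) -sumrN; apply: eq_bigr => e _.
  rewrite col_mxEd mxE.
  case: (enum_val e) => k l /=.
  have [->|_] := eqVneq i l.
    by have [->|_] := eqVneq l k; rewrite /=; ring.
  by have [->|_] := eqVneq i k; rewrite /=; ring.
- apply: hgap => i; rewrite -[RHS](hrow (lshift _ (lshift _ i))).
  by apply: eq_bigr => e _; rewrite !col_mxEu.
- apply: hgap => i; rewrite -[RHS](hrow (lshift _ (rshift _ i))).
  by apply: eq_bigr => e _; rewrite col_mxEu col_mxEd.
Qed.

(** * Bounds on the number of contacts *)
Section Packing.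
Variables (R : realType) (n : nat) (p : 'I_n -> 'rV[R]_2) (r : 'I_n -> R).
Hypothesis packing : disk_packing p r.

Let r_gt0 i : 0 < r i.
Proof. exact: packing.1. Qed.

Definition center_x i := p i 0 0.
Definition center_y i := p i 0 1.

Let apart i j : i != j ->
  (r i + r j) ^+ 2 <= (center_x i - center_x j) ^+ 2 + (center_y i - center_y j) ^+ 2.
Proof.
move=> ij; have := disk_packing_apart packing ij.
by rewrite dotE !mxE !expr2.
Qed.

Let C := contacts p r.

Let contact_lt e : e \in C -> (e.1 < e.2)%N.
Proof. by rewrite inE => /andP[]. Qed.

Let contact_touch e : e \in C -> touch center_x center_y r e.1 e.2.
Proof. by rewrite inE => /andP[_ /(tangent_touch r_gt0)]. Qed.

Lemma centers_distinct i j : i != j -> center_x i != center_x j \/ center_y i != center_y j.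
Proof.
move=> ij; apply/orP; apply: contraTT (apart ij).
rewrite negb_or !negbK => /andP[/eqP -> /eqP ->]; rewrite !subrr expr0n addr0 -ltNge.
by rewrite exprn_gt0 // addr_gt0.
Qed.

Let B := contact_matrix center_x center_y r C.
Let F := flex_matrix center_x center_y C.
Let isoM := isometry_matrix center_x center_y.

(** A derivation turns the tangency equations into their linearization. *)
Lemma derivation_in_kernel (K : R -> Prop) (D : R -> R) : derivation_on K D ->
  (forall i, [/\ K (center_x i), K (center_y i) & K (r i)]) ->
  pack3 (D \o center_x) (D \o center_y) (D \o r) *m B = 0.
Proof.
move=> KD Kc; apply/rowP => e; rewrite mul_contact_matrix mxE /=.
have [_ eq] := contact_touch (enum_valP e).
move: (enum_val e).1 (enum_val e).2 eq => i j eq.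
have [Kxi Kyi Kri] := Kc i; have [Kxj Kyj Krj] := Kc j.
have sq a : K a -> K (a ^+ 2) /\ D (a ^+ 2) = 2 * (a * D a).
  move=> Ka; rewrite expr2; split; first exact: (domM KD).
  by rewrite (derM KD) //; ring.
have [Kx Dx] := sq _ (domB KD Kxi Kxj); have [Ky Dy] := sq _ (domB KD Kyi Kyj).
have [Kr Dr] := sq _ (domD KD Kri Krj).
have := congr1 D eq; rewrite (derD KD) // Dx Dy Dr !(derB KD) // (derD KD) // => h.
by lra.
Qed.

Section Count.
Variables (hn : (4 <= n)%N).
Hypothesis gen : generic (rbar hn r).

Let rn := last_disk hn.

(** The differential of [rbar], with the quotients by r_n scaled by r_n: the
    derivative of rho = r_i / r_n times r_n is r_i' - rho r_n'. *)
Definition ratio_matrix : 'M[R]_(n + n + n, n.-1) :=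
  col_mx 0 (\matrix_(j, k) let i := widen_ord (leq_pred n) k in
    (j == i)%:R - (j == rn)%:R * (if outer i then 0 else rbar hn r k)).

Lemma mul_ratio_matrix a b c k : let i := widen_ord (leq_pred n) k in
  (pack3 a b c *m ratio_matrix) 0 k = c i - c rn * (if outer i then 0 else rbar hn r k).
Proof.
move=> i; rewrite mul_row_col mulmx0 add0r mxE.
under eq_bigr => j _ do rewrite !mxE mulrBr mulrA.
by rewrite sumrB -mulr_suml !sum_delta.
Qed.

Lemma ratio_matrix_onto : \rank (kermx B *m ratio_matrix) = n.-1.
Proof.
apply/eqP; rewrite -/(row_full _) -sub1mx; apply/row_subP => k.
pose c (l : 'I_n.-1) : R :=
  row k 1%:M 0 l / (if outer (widen_ord (leq_pred n) l) then 1 else r rn).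
have [K [D [KD KDv Ks]]] := generic_derivation c
  (codom center_x ++ codom center_y ++ codom r) gen.
have Kc i : [/\ K (center_x i), K (center_y i) & K (r i)].
  by split; apply: Ks; rewrite !mem_cat codom_f ?orbT.
pose v := pack3 (D \o center_x) (D \o center_y) (D \o r).
have vK : (v <= kermx B)%MS by apply/sub_kermxP; exact: (derivation_in_kernel KD Kc).
suff <- : v *m ratio_matrix = row k 1%:M by apply: submxMr.
apply/rowP => l; rewrite mul_ratio_matrix /=.
have [Kl Dl] := KDv l; move: Dl Kl; rewrite /c /rbar.
set i := widen_ord _ l; case: (outer i) => Dl Kl.
  by rewrite mulr0 subr0 Dl divr1.
have rn0 : r rn != 0 by rewrite gt_eqF.
have [_ _ Kr] := Kc rn.
have e : r i = r i / r rn * r rn by rewrite divfK.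
rewrite [in D (r i)]e (derM KD) // Dl -/rn; field; exact: rn0.
Qed.

Lemma isometry_in_kernel :
  (row_mx isoM 0 <= kermx B :&: kermx ratio_matrix)%MS.
Proof.
rewrite sub_capmx; apply/andP; split; apply/sub_kermxP.
  by rewrite mul_row_col isometry_flex mul0mx addr0.
by rewrite mul_row_col mulmx0 mul0mx addr0.
Qed.

Lemma contacts_upper_bound : (#|C| <= 2 * n - 2)%N.
Proof.
have rankB : \rank B = #|C| by apply: contact_matrix_rank.
have rankK : \rank (kermx B) = (n + n + n - #|C|)%N by rewrite mxrank_ker rankB.
have Cle : (#|C| <= n + n + n)%N by rewrite -rankB rank_leq_row.
have := mxrank_mul_ker (kermx B) ratio_matrix.
rewrite ratio_matrix_onto rankK => sum.
have three : (3 <= \rank (kermx B :&: kermx ratio_matrix))%N.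
  apply: leq_trans (mxrankS isometry_in_kernel).
  have h0 : (0 < n)%N by apply: leq_trans hn.
  have h1 : (1 < n)%N by apply: leq_trans hn.
  have free : row_free isoM.
    by apply: (@isometry_free _ _ _ _ (Ordinal h0) (Ordinal h1)); apply: centers_distinct.
  have eI : row_mx isoM 0 *m col_mx 1%:M (0 : 'M[R]_(n, n + n)) = isoM.
    by rewrite mul_row_col mulmx1 mul0mx addr0.
  have := mxrankM_maxl (row_mx isoM 0) (col_mx 1%:M (0 : 'M[R]_(n, n + n))).
  by rewrite eI (eqP free).
have arith (k c : nat) : (n.-1 + k = n + n + n - c)%N -> (3 <= k)%N ->
    (c <= n + n + n)%N -> (c <= 2 * n - 2)%N by lia.
exact: arith sum three Cle.
Qed.

End Count.

Definition flex_of (a b : 'I_n -> R) (i : 'I_n) : 'rV[R]_2 :=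
  \row_k (if k == 0 then a i else b i).

Lemma flex_of0 a b i : flex_of a b i 0 0 = a i.
Proof. by rewrite mxE. Qed.

Lemma flex_of1 a b i : flex_of a b i 0 1 = b i.
Proof. by rewrite mxE. Qed.

Lemma tangentC i j : tangent p r i j -> tangent p r j i.
Proof.
move=> /andP[ij /eqP e]; apply/andP; split; first by rewrite eq_sym.
apply/eqP; rewrite [RHS]addrC -e /enorm; congr Num.sqrt.
by rewrite !dotE !mxE; ring.
Qed.

Lemma flex_criterion a b :
  (forall e, (if outer (enum_val e).1 && outer (enum_val e).2
    then (pack2 a b *m F) 0 e = 0 else 0 <= (pack2 a b *m F) 0 e)) ->
  inf_tensegrity_flex p r (flex_of a b).
Proof.
move=> h i j tij.
have main k l : (k, l) \in C -> if outer k && outer l then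
    dot (p l - p k) (flex_of a b l - flex_of a b k) = 0
    else 0 <= dot (p l - p k) (flex_of a b l - flex_of a b k).
  move=> klC; have := h (enum_rank_in klC (k, l)); rewrite mul_flex_matrix enum_rankK_in //=.
  by rewrite dotE !mxE /= ![(_ - _) * (p _ _ _ - _)]mulrC.
have [ij|ji|/val_inj eq] := ltngtP i j.
- by apply: main; rewrite inE ij tij.
- have := main j i; rewrite inE ji tangentC // => /(_ isT).
  have -> : dot (p i - p j) (flex_of a b i - flex_of a b j) =
     dot (p j - p i) (flex_of a b j - flex_of a b i).
    by rewrite !dotE !mxE; ring.
  by rewrite andbC.
- by move: tij; rewrite eq /tangent eqxx.
Qed.

Lemma trivial_flex_isometry a b : trivial_flex p (flex_of a b) -> (pack2 a b <= isoM)%MS.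
Proof.
move=> [A [t [skew eq]]].
have A00 : A 0 0 = 0 by have := congr1 (fun M : 'M[R]_2 => M 0 0) skew; rewrite !mxE; lra.
have A11 : A 1 1 = 0 by have := congr1 (fun M : 'M[R]_2 => M 1 1) skew; rewrite !mxE; lra.
have A10 : A 1 0 = - A 0 1 by have := congr1 (fun M : 'M[R]_2 => M 0 1) skew; rewrite !mxE.
have mulE (u : 'rV[R]_2) k : (u *m A) 0 k = u 0 0 * A 0 k + u 0 1 * A 1 k.
  rewrite mxE !big_ord_recr big_ord0 /= add0r.
  by congr (u 0 _ * A _ k + u 0 _ * A _ k); apply: val_inj.
have aE i : a i = t 0 0 - A 0 1 * center_y i.
  have := congr1 (fun M : 'rV[R]_2 => M 0 0) (eq i); rewrite flex_of0 mxE mulE A00 A10 => ->.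
  by rewrite /center_y; ring.
have bE i : b i = t 0 1 + A 0 1 * center_x i.
  have := congr1 (fun M : 'rV[R]_2 => M 0 1) (eq i); rewrite flex_of1 mxE mulE A11 => ->.
  by rewrite /center_x; ring.
suff -> : pack2 a b = row_mx (t 0 0)%:M (row_mx (t 0 1)%:M (A 0 1)%:M) *m isoM.
  exact: submxMl.
rewrite mul_isometry /pack2; congr row_mx; apply/rowP => i; rewrite !mxE.
  by rewrite aE.
by rewrite bE.
Qed.

Lemma card_outer_contacts : (forall e, e \in C -> outer e.1 && outer e.2) -> (#|C| <= 3)%N.
Proof.
move=> out; pose f (e : 'I_n * 'I_n) : 'I_3 := inord (e.1 + e.2).-1.
have inj : {in C &, injective f}.
  move=> [a b] [c d] abC cdC /(congr1 val) /=; rewrite /f /=.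
  have := contact_lt abC; have := contact_lt cdC.
  have := out _ abC; have := out _ cdC; rewrite /outer /= => /andP[h1 h2] /andP[h3 h4] h5 h6.
  rewrite !inordK; [|by lia|by lia] => h7.
  by congr (_, _); apply: val_inj => /=; lia.
by rewrite -(card_in_imset inj); apply: leq_trans (max_card _) _; rewrite card_ord.
Qed.

(** If there were at most 2n - 3 contacts, the contact conditions would be
    independent, and the vector [u] of opening rates, 0 on the outer triangle and
    1 elsewhere, would be realized by a motion.  That motion is a flex, hence an
    isometry, so [u] vanishes and all contacts are among the three outer ones;
    but the rank of the conditions is at least 2n - 3, which exceeds 3. *)
Lemma contacts_lower_bound : (4 <= n)%N -> inf_collectively_jammed p r ->
  (2 * n - 2 <= #|C|)%N.
Proof.
move=> hn jammed; rewrite leqNgt; apply/negP => few.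
have jam (v : 'rV[R]_(n + n)) : (forall e, (if outer (enum_val e).1 && outer (enum_val e).2
    then (v *m F) 0 e = 0 else 0 <= (v *m F) 0 e)) -> (v <= isoM)%MS.
  rewrite (pack2K v) => h; apply: trivial_flex_isometry; apply: jammed.
  exact: flex_criterion.
have kerI : (kermx F <= isoM)%MS.
  apply/row_subP => k; apply: jam => e.
  have -> : (row k (kermx F) *m F) = 0 by rewrite -row_mul mulmx_ker row0.
  by rewrite mxE lexx; case: ifP.
have rankI : (\rank isoM <= 3)%N by apply: rank_leq_row.
have := leq_trans (mxrankS kerI) rankI; rewrite mxrank_ker => rk.
have Fle : (\rank F <= #|C|)%N by apply: rank_leq_col.
have full : row_full F by rewrite /row_full; lia.
pose u : 'rV[R]_#|C| := \row_e (~~ (outer (enum_val e).1 && outer (enum_val e).2))%:R.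
have [v uv] : exists v, v *m F = u.
  have /submxP[v ->] : (u <= F)%MS by apply: submx_full.
  by exists v.
have vI : (v <= isoM)%MS.
  apply: jam => e; rewrite uv mxE; case: (_ && _) => //=.
have u0 : u = 0.
  rewrite -uv; have /submxP[w ->] := vI.
  by rewrite -mulmxA isometry_flex mulmx0.
have small : (#|C| <= 3)%N.
  apply: card_outer_contacts => e eC.
  have := congr1 (fun M : 'rV[R]_#|C| => M 0 (enum_rank_in eC e)) u0.
  rewrite !mxE enum_rankK_in //; case: (_ && _) => //= /eqP.
  by rewrite oner_eq0.
have arith (k c : nat) : (n + n - k <= 3)%N -> (k <= c)%N -> (c <= 3)%N -> False by lia.
exact: arith rk Fle small.
Qed.

End Packing.

Theorem theorem4p6 (R : realType) (n : nat) (hn : (4 <= n)%N)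
    (p : 'I_n -> 'rV[R]_2) (r : 'I_n -> R)
    (hP : tricusp_packing p r)
    (hgen : generic (rbar hn r)) :
  (#|contacts p r| <= 2 * n - 2)%N /\
  (inf_collectively_jammed p r -> #|contacts p r| = (2 * n - 2)%N).
Proof.
have [packing _ _] := hP.
have upper := contacts_upper_bound packing hgen.
split=> // jammed; apply/eqP; rewrite eqn_leq upper /=.
exact: contacts_lower_bound jammed.
Qed.
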